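(* Up to isomorphism of lattice polytopes there are exactly $100$ three-dimensional terminal reflexive polytopes. A three-dimensional reflexive polytope $P\subseteq M_{\mathbb R}$ is terminal if and only if every facet of $P$ is either a simplex whose vertices form a $\mathbb Z$-basis of $M$, or a parallelogram $\mathrm{conv}(v,w,x,y)$ where $v,x,w$ form a $\mathbb Z$-basis of $M$ and the equation $v+x=w+y$ is satisfied.
   Context: Let $M\cong\mathbb Z^3$ be a lattice with dual lattice $N$. A three-dimensional reflexive polytope is a three-dimensional lattice polytope $P\subseteq M_{\mathbb R}$ (vertices in $M$) with $0\in\mathrm{int}\,P$ whose dual $P^*=\{y\in N_{\mathbb R}:\langle x,y\rangle\ge -1\ \forall x\in P\}$ is a lattice polytope. $P$ is terminal if $P\cap M=\{0\}\cup\mathcal V(P)$, where $\mathcal V(P)$ is the set of vertices. An isomorphism of lattice polytopes is an isomorphism of the lattices whose real linear extension maps one polytope onto the other. *)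

(* Defs.v *)
From HB Require Import structures.
From mathcomp Require Import all_boot all_order all_algebra.
From mathcomp Require Import all_classical all_reals all_analysis.

Set Implicit Arguments.
Unset Strict Implicit.
Unset Printing Implicit Defensive.

Import Order.TTheory GRing.Theory Num.Theory.
Import numFieldNormedType.Exports.

Local Open Scope classical_set_scope.
Local Open Scope ring_scope.

(* The lattice M is Z^n = 'rV[int]_n, inside M_R = R^n = 'rV[R]_n via embZ.
   The dual lattice N is also written Z^n, by means of the dual basis, so that
   the pairing of M_R and N_R becomes the dot product. *)

Definition embZ {R : realType} {n : nat} (m : 'rV[int]_n) : 'rV[R]_n :=
  map_mx intr m.

Definition pairing {R : realType} {n : nat} (x y : 'rV[R]_n) : R :=
  \sum_(i < n) x 0 i * y 0 i.

Section Polytopes.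
Context {R : realType} {n : nat}.
Implicit Types (A F P Q : set 'rV[R]_n).

Definition lattice : set 'rV[R]_n := range embZ.

Definition conv A : set 'rV[R]_n := smallest (@convex_set R 'rV[R]_n) A.

Definition polytope P : Prop :=
  exists2 S : set 'rV[R]_n, finite_set S & P = conv S.

Definition edge_mx {k : nat} (v : 'I_k.+1 -> 'rV[R]_n) : 'M[R]_(k, n) :=
  \matrix_(i < k) (v (lift ord0 i) - v ord0).

Definition affinely_independent {k : nat} (v : 'I_k.+1 -> 'rV[R]_n) : Prop :=
  row_free (edge_mx v).

(* The affine hull of A has dimension k: some k.+1 points of A form an affine
   basis of it. The empty set has no dimension in this sense. *)
Definition has_dim A (k : nat) : Prop :=
  exists v : 'I_k.+1 -> 'rV[R]_n,
    [/\ affinely_independent v,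
        forall i, A (v i) &
        forall x, A x -> (x - v ord0 <= edge_mx v)%MS].

(* With u = 0 this includes P itself and the empty face. *)
Definition is_face P F : Prop :=
  exists (u : 'rV[R]_n) (c : R),
    (forall x, P x -> c <= pairing x u) /\
    F = P `&` [set x | pairing x u = c].

Definition vertices P : set 'rV[R]_n := [set v | is_face P [set v]].

Definition is_facet P F : Prop :=
  is_face P F /\ exists k : nat, has_dim P k.+1 /\ has_dim F k.

Definition lattice_polytope P : Prop :=
  polytope P /\ vertices P `<=` lattice.

Definition dual P : set 'rV[R]_n :=
  [set y | forall x, P x -> -1 <= pairing x y].

Definition reflexive_polytope P : Prop :=
  [/\ lattice_polytope P, has_dim P n, interior P 0 &
      lattice_polytope (dual P)].

Definition terminal P : Prop := P `&` lattice = [set 0] `|` vertices P.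

Definition lattice_isomorphic P Q : Prop :=
  exists (phi : {additive 'rV[int]_n -> 'rV[int]_n})
         (phiR : {linear 'rV[R]_n -> 'rV[R]_n}),
    [/\ bijective phi,
        forall m : 'rV[int]_n, phiR (embZ m) = embZ (phi m) &
        phiR @` P = Q].

Definition is_simplex A : Prop :=
  exists (k : nat) (v : 'I_k.+1 -> 'rV[R]_n),
    affinely_independent v /\ A = conv (range v).

End Polytopes.

Definition Z_basis {n k : nat} (b : k.-tuple 'rV[int]_n) : Prop :=
  forall m : 'rV[int]_n,
    exists! c : 'rV[int]_k, m = \sum_(i < k) c 0 i *: tnth b i.

Definition unimodular_simplex {R : realType} {n : nat} (F : set 'rV[R]_n) :
    Prop :=
  is_simplex F /\
  exists b : n.-tuple 'rV[int]_n,
    Z_basis b /\ vertices F = embZ @` [set` b].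

Definition unimodular_parallelogram {R : realType} (F : set 'rV[R]_3) : Prop :=
  exists v w x y : 'rV[int]_3,
    [/\ F = conv (embZ @` [set` [:: v; w; x; y]]),
        Z_basis [tuple v; x; w] & v + x = w + y].

(* Main.v *)
Require Import Defs.
From mathcomp Require Import all_boot all_order all_algebra.
From mathcomp Require Import all_classical all_reals all_analysis.
From Stdlib Require Import ZArith Lia.
From mathcomp Require Import ssrZ zify.

(** Both claims reduce to the finite set [V] of vertices of a reflexive polytope
    [P] and to its facet triples, that is, the triples of linearly independent
    vertices lying on a common facet.

    Facets. The form that defines the facet of a triple [a], [b], [c] is a vertex
    of the dual polytope, hence integral ([facet_integral]). If [P] is terminal
    and [d] is the determinant of the triple, the fractional parts of the
    coordinates of a lattice point with respect to [a], [b], [c] add up to an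
    integer; if they do not vanish, they give a lattice point of the triangle
    that is not a vertex, so [d] is [1] or [-1] ([terminal_facet_det]). When all
    facet triples are unimodular, a further vertex of the facet has coordinates
    [0], [1] or [-1] of sum [1], which leaves a triangle or a parallelogram
    ([facet_shape]). Conversely the cones over unimodular facet triples cover
    space ([cone_cover]); a lattice point in such a cone has integral
    coordinates, so the only ones in [P] are the origin and the vertices
    ([hull_lattice]). Thus terminality is unimodularity of the facet triples.

    Classification. Let [s] be the sum of the vertices and choose a facet on
    whose plane [s] is highest. Take three of its vertices as basis, so that
    the height is the sum of the coordinates. Two facts make the problem finite.
    The coordinates of [s] along the inner normals of the edges are nonnegative
    ([coord_ge0_special]), so the heights of the vertices add up to at least
    [0]; as at most four of them have height [1] and the others have height at
    most [0], the latter are limited by a budget of 3 or 4. And the facet across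
    an edge is obtained by an integral rotation, which bounds the coordinate
    of every vertex across that edge from below in terms of its height
    ([coord_lower_bound]). Moreover two vertices congruent modulo 2 are opposite,
    the midpoint being a lattice point. An exhaustive search over the sets of
    points subject to these conditions finds a member of an explicit list of
    100 vertex sets, up to a change of basis, whenever all facet triples of the
    set are unimodular ([unimodular_hull_classification]).

    Each set on the list is the vertex set of a terminal reflexive polytope: by
    [cone_cover] its hull is cut out by the planes of the facet triples
    ([hullP], [hull_reflexive]). No two are isomorphic, because two numbers
    computed from determinants of vertices differ
    ([lattice_isomorphic_invariant]).

    Convexity enters through Farkas' lemma, from which points outside a polytope
    are separated from it ([separation]) and a polytope is the hull of its
    vertices ([polytope_vertices]). *)

Set Implicit Arguments.
Unset Strict Implicit.
Unset Printing Implicit Defensive.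

Local Open Scope Z_scope.
Local Arguments Z.mul : simpl never.
Local Arguments Z.add : simpl never.
Local Arguments Z.sub : simpl never.
Local Arguments Z.opp : simpl never.

(** * Integer vectors of length three *)

Definition pt := (Z * Z * Z)%type.

Definition dot (a b : pt) : Z :=
  let: (a1, a2, a3) := a in let: (b1, b2, b3) := b in
  a1 * b1 + a2 * b2 + a3 * b3.

Definition add (a b : pt) : pt :=
  let: (a1, a2, a3) := a in let: (b1, b2, b3) := b in
  (a1 + b1, a2 + b2, a3 + b3).

Definition scale (k : Z) (a : pt) : pt :=
  let: (a1, a2, a3) := a in (k * a1, k * a2, k * a3).

Definition opp (a : pt) : pt := scale (-1) a.

Definition cross (a b : pt) : pt :=
  let: (a1, a2, a3) := a in let: (b1, b2, b3) := b in
  (a2 * b3 - a3 * b2, a3 * b1 - a1 * b3, a1 * b2 - a2 * b1).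

Definition det (a b c : pt) : Z := dot a (cross b c).

(** For a triple of determinant [+1] or [-1], the vectors [dual_vec a b c],
    [dual_vec b c a] and [dual_vec c a b] form its dual basis; the sign of the
    determinant is part of the formula so that exchanging two vectors of the
    triple exchanges the dual vectors as well. *)
Definition dual_vec (a b c : pt) : pt := scale (det a b c) (cross b c).

(** The outer normal of the plane through [a], [b], [c]. On that plane it takes
    the value [det a b c ^ 2], which is [1] for a unimodular triple. *)
Definition facet_vec (a b c : pt) : pt :=
  add (add (dual_vec a b c) (dual_vec b c a)) (dual_vec c a b).

Definition coords (a b c v : pt) : pt :=
  (dot v (dual_vec a b c), dot v (dual_vec b c a), dot v (dual_vec c a b)).

Definition frame (a b c x : pt) : pt :=
  let: (x1, x2, x3) := x in add (add (scale x1 a) (scale x2 b)) (scale x3 c).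

Definition e1 : pt := (1, 0, 0).
Definition e2 : pt := (0, 1, 0).
Definition e3 : pt := (0, 0, 1).

Definition vsum (V : seq pt) : pt := foldr add (0, 0, 0) V.

(* Splits every vector quantified in the goal into coordinates. *)
Ltac split_pt :=
  repeat (let x := fresh in let y := fresh in let z := fresh in
          move=> [[x y] z]).

Ltac ptring :=
  split_pt;
  rewrite /frame /coords /facet_vec /dual_vec /det /opp /e1 /e2 /e3 /=;
  try congr (_, _, _); ring.

Lemma det_frame a b c x y z :
  det (frame a b c x) (frame a b c y) (frame a b c z) =
  det a b c * det x y z.
Proof. move: a b c x y z; ptring. Qed.

Lemma frame_coords_det a b c v :
  frame a b c (coords a b c v) = scale (det a b c * det a b c) v.
Proof. move: a b c v; ptring. Qed.

Lemma coords_frame_det a b c x :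
  coords a b c (frame a b c x) = scale (det a b c * det a b c) x.
Proof. move: a b c x; ptring. Qed.

Lemma scale1 v : scale 1 v = v.
Proof. move: v; ptring. Qed.

Lemma frame_coords a b c v :
  det a b c * det a b c = 1 -> frame a b c (coords a b c v) = v.
Proof. by move=> D; rewrite frame_coords_det D scale1. Qed.

Lemma coords_frame a b c x :
  det a b c * det a b c = 1 -> coords a b c (frame a b c x) = x.
Proof. by move=> D; rewrite coords_frame_det D scale1. Qed.

Lemma dot_facet_det a b c v :
  dot v (facet_vec a b c) =
  det a b c * (det v b c + det a v c + det a b v).
Proof. move: a b c v; ptring. Qed.

Lemma dot_facet_coords a b c v :
  dot v (facet_vec a b c) = dot (1, 1, 1) (coords a b c v).
Proof. move: a b c v; ptring. Qed.

Lemma dot_add v x y : dot v (add x y) = dot v x + dot v y.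
Proof. move: v x y; ptring. Qed.

Lemma dot_addl v x y : dot (add x y) v = dot x v + dot y v.
Proof. move: v x y; ptring. Qed.

Lemma dot_scale v k x : dot v (scale k x) = k * dot v x.
Proof. move: v x; ptring. Qed.

Lemma dot_scalel v k x : dot (scale k x) v = k * dot x v.
Proof. move: v x; ptring. Qed.

Lemma add_comm x y : add x y = add y x.
Proof. move: x y; ptring. Qed.

Lemma coords_add a b c x y :
  coords a b c (add x y) = add (coords a b c x) (coords a b c y).
Proof. move: a b c x y; ptring. Qed.

Lemma dual_vecC a b c : dual_vec a c b = dual_vec a b c.
Proof. move: a b c; ptring. Qed.

Lemma det_cyc a b c : det b c a = det a b c.
Proof. move: a b c; ptring. Qed.

Lemma det_swap a b c : det b a c = - det a b c.
Proof. move: a b c; ptring. Qed.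

Lemma facet_vec_cyc a b c : facet_vec b c a = facet_vec a b c.
Proof. move: a b c; ptring. Qed.

Lemma facet_vec_swap a b c : facet_vec b a c = facet_vec a b c.
Proof. move: a b c; ptring. Qed.

(** * Triples spanning a facet *)

Definition supporting (V : seq pt) (a b c : pt) : bool :=
  let d := det a b c in let n := facet_vec a b c in
  (d != 0) && all (fun v => dot v n <=? d * d) V.

(** When [V] is the vertex set of a polytope [P] with the origin inside, these
    are the triples of linearly independent vertices of a common facet. *)
Definition facet_triple (V : seq pt) (a b c : pt) : bool :=
  [&& a \in V, b \in V, c \in V & supporting V a b c].

(** This is what reflexivity and terminality say about the facets: facet triples
    are unimodular, and, since the origin is an interior point, no facet triple
    has all of [V] on one side of the plane through the origin and one of its
    edges. *)
Definition unimodular_hull (V : seq pt) : Prop :=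
  forall a b c, facet_triple V a b c ->
    det a b c * det a b c = 1 /\
    exists2 v, v \in V & dot v (dual_vec a b c) < 0.

Lemma facet_tripleP V a b c :
  reflect [/\ det a b c <> 0, a \in V, b \in V, c \in V &
             forall v, v \in V ->
               dot v (facet_vec a b c) <= det a b c * det a b c]
          (facet_triple V a b c).
Proof.
apply: (iffP idP) => [/and4P[? ? ? /andP[/eqP ? /allP h]]|[D aV bV cV h]].
  by split=> // v /h; lia.
apply/and4P; split=> //; apply/andP; split; first exact/eqP.
by apply/allP => v /h; lia.
Qed.

Lemma facet_triple_cyc V a b c : facet_triple V a b c -> facet_triple V b c a.
Proof.
by move=> /facet_tripleP[*]; apply/facet_tripleP; rewrite facet_vec_cyc det_cyc.
Qed.

Lemma facet_triple_swap V a b c : facet_triple V a b c -> facet_triple V b a c.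
Proof.
move=> /facet_tripleP[? ? ? ? h]; apply/facet_tripleP.
rewrite facet_vec_swap det_swap; split=> // [|v /h]; lia.
Qed.

Lemma eq_mem_facet_triple V W a b c :
  V =i W -> facet_triple V a b c = facet_triple W a b c.
Proof. by move=> VW; rewrite /facet_triple /supporting !VW (eq_all_r VW). Qed.

Lemma eq_mem_unimodular_hull V W :
  V =i W -> unimodular_hull V -> unimodular_hull W.
Proof.
move=> VW h a b c; rewrite -(eq_mem_facet_triple _ _ _ VW) => /h[? [v vV ?]].
by split=> //; exists v; rewrite -?VW.
Qed.

Section UnimodularHull.
Variable V : seq pt.
Hypothesis V_unimodular : unimodular_hull V.

Lemma facet_det a b c : facet_triple V a b c -> det a b c * det a b c = 1.
Proof. by move=> /V_unimodular[]. Qed.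

Lemma facet_le1 a b c v :
  facet_triple V a b c -> v \in V -> dot v (facet_vec a b c) <= 1.
Proof.
move=> abc vV; have [_ _ _ _ /(_ v vV)] := facet_tripleP _ _ _ _ abc.
by rewrite facet_det.
Qed.

Lemma det_frame_fst a b c x :
  det (frame a b c x) b c = dot (1, 0, 0) x * det a b c.
Proof. move: a b c x; ptring. Qed.

Lemma facet_vec_frame_fst a b c x1 x2 x3 :
  facet_vec (frame a b c (x1, x2, x3)) b c =
  scale x1 (add (scale (1 - x2 - x3) (dual_vec a b c))
                (scale x1 (add (dual_vec b c a) (dual_vec c a b)))).
Proof. move: a b c; ptring. Qed.

(** Replacing the vertex [a] by another vertex [v] of the same facet gives a
    facet triple as soon as [v] is off the line [b c], and then the
    [a]-coordinate of [v] is the ratio of two determinants equal to [+1] or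
    [-1]. *)
Lemma facet_point_coord a b c v :
  facet_triple V a b c -> v \in V -> dot v (facet_vec a b c) = 1 ->
  dot v (dual_vec a b c) = 0 \/
  dot v (dual_vec a b c) * dot v (dual_vec a b c) = 1.
Proof.
move=> abc vV hv; have D := facet_det abc.
have [_ aV bV cV abcV] := facet_tripleP _ _ _ _ abc.
have [->|/eqP nz] := eqVneq (dot v (dual_vec a b c)) 0; [by left | right].
move: (frame_coords v D) hv; rewrite dot_facet_coords /coords.
set x1 := dot v _ in nz *; set x2 := dot v _; set x3 := dot v _ => vE hv.
have Dv : det v b c = x1 * det a b c by rewrite -vE det_frame_fst /=; ring.
suff vbc : facet_triple V v b c by have := facet_det vbc; rewrite Dv; nia.
apply/facet_tripleP; split => //; first by rewrite Dv; nia.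
move=> w wV; have := abcV w wV; rewrite Dv -{1}vE facet_vec_frame_fst.
rewrite /facet_vec !(dot_scale, dot_add) D => hw.
have -> : 1 - x2 - x3 = x1 by move: hv; rewrite /=; lia.
by nia.
Qed.

Definition triangle (a b c : pt) : Prop :=
  facet_triple V a b c /\
  forall v, v \in V -> dot v (facet_vec a b c) = 1 -> v \in [:: a; b; c].

(** Here [a b] is a diagonal and [c] and [a + b - c] are the other two
    vertices. *)
Definition parallelogram (a b c : pt) : Prop :=
  [/\ facet_triple V a b c, add (add a b) (opp c) \in V &
    forall v, v \in V -> dot v (facet_vec a b c) = 1 ->
      v \in [:: a; b; c; add (add a b) (opp c)]].

Lemma facet_point_cases a b c v :
  facet_triple V a b c -> v \in V -> dot v (facet_vec a b c) = 1 ->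
  [\/ v \in [:: a; b; c], v = add (add a b) (opp c),
      v = add (add b c) (opp a) | v = add (add c a) (opp b)].
Proof.
move=> abc vV hv; have D := facet_det abc.
have bca := facet_triple_cyc abc; have cab := facet_triple_cyc bca.
have ha := facet_point_coord abc vV hv.
have hb := facet_point_coord bca vV; rewrite facet_vec_cyc in hb.
have hc := facet_point_coord cab vV; rewrite 2!facet_vec_cyc in hc.
move: (frame_coords v D) (hv) ha {hb hc}(hb hv) (hc hv).
rewrite dot_facet_coords /coords.
set x1 := dot v _; set x2 := dot v _; set x3 := dot v _ => <- /= hx h1 h2 h3.
have : [\/ [/\ x1 = 1, x2 = 0 & x3 = 0], [/\ x1 = 0, x2 = 1 & x3 = 0],
     [/\ x1 = 0, x2 = 0 & x3 = 1] |
  [\/ [/\ x1 = 1, x2 = 1 & x3 = -1], [/\ x1 = -1, x2 = 1 & x3 = 1] |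
      [/\ x1 = 1, x2 = -1 & x3 = 1]]].
  have c1 : x1 = 0 \/ x1 = 1 \/ x1 = -1 by nia.
  have c2 : x2 = 0 \/ x2 = 1 \/ x2 = -1 by nia.
  have : x3 = 1 - x1 - x2 by lia.
  move: h3; case: c1 => [->|[->|->]]; case: c2 => [->|[->|->]] /= + E;
    rewrite E => h3; try lia; do ?[by constructor 1|by constructor 2|
    by constructor 3|
    by constructor 4; constructor 1|by constructor 4; constructor 2|
    by constructor 4; constructor 3].
clear; case=> [[-> -> ->]|[-> -> ->]|[-> -> ->]|[] [-> -> ->]].
- constructor 1; rewrite !inE; apply/orP; left; apply/eqP.
  by clear; move: a b c; ptring.
- constructor 1; rewrite !inE; apply/orP; right; apply/orP; left; apply/eqP.
  by clear; move: a b c; ptring.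
- constructor 1; rewrite !inE; apply/orP; right; apply/orP; right; apply/eqP.
  by clear; move: a b c; ptring.
- constructor 2; by clear; move: a b c; ptring.
- constructor 3; by clear; move: a b c; ptring.
- constructor 4; by clear; move: a b c; ptring.
Qed.

Lemma dot_facet_fst a b c : dot a (facet_vec a b c) = det a b c * det a b c.
Proof. move: a b c; ptring. Qed.

Lemma dot_facet_snd a b c : dot b (facet_vec a b c) = det a b c * det a b c.
Proof. move: a b c; ptring. Qed.

Lemma dot_facet_trd a b c : dot c (facet_vec a b c) = det a b c * det a b c.
Proof. move: a b c; ptring. Qed.

Lemma facet_vec_opp a b c :
  facet_vec a b (add (add a b) (opp c)) = facet_vec a b c.
Proof. move: a b c; ptring. Qed.

Lemma facet_vec_opp2 a b c :
  facet_vec c (add (add a b) (opp c)) a = facet_vec a b c.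
Proof. move: a b c; ptring. Qed.

Lemma det_opp a b c : det a b (add (add a b) (opp c)) = - det a b c.
Proof. move: a b c; ptring. Qed.

Lemma det_opp2 a b c : det c (add (add a b) (opp c)) a = - det a b c.
Proof. move: a b c; ptring. Qed.

Lemma add_opp_opp a b c : add (add a b) (opp (add (add a b) (opp c))) = c.
Proof. move: a b c; ptring. Qed.

Lemma add_opp_opp2 a b c : add (add c (add (add a b) (opp c))) (opp a) = b.
Proof. move: a b c; ptring. Qed.

Lemma triangle_cyc a b c : triangle a b c -> triangle b c a.
Proof.
move=> [/facet_triple_cyc abc h]; split=> // v; rewrite facet_vec_cyc => vV.
by move/(h v vV); rewrite !inE => /or3P[] -> ; rewrite ?orbT.
Qed.

Lemma triangle_swap a b c : triangle a b c -> triangle b a c.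
Proof.
move=> [/facet_triple_swap abc h]; split=> // v; rewrite facet_vec_swap => vV.
by move/(h v vV); rewrite !inE => /or3P[] -> ; rewrite ?orbT.
Qed.

Lemma parallelogram_swap a b c : parallelogram a b c -> parallelogram b a c.
Proof.
move=> [/facet_triple_swap abc dV h]; split; rewrite // (add_comm b) //.
move=> v; rewrite facet_vec_swap => vV /(h v vV).
by rewrite !inE => /or4P[] -> ; rewrite ?orbT.
Qed.

Lemma parallelogram_opp a b c :
  parallelogram a b c -> parallelogram a b (add (add a b) (opp c)).
Proof.
move=> [abc dV h]; have [D aV bV cV abcV] := facet_tripleP _ _ _ _ abc.
split; rewrite ?add_opp_opp //.
  apply/facet_tripleP; rewrite facet_vec_opp det_opp.
  by split=> // [|v /abcV]; lia.
move=> v; rewrite facet_vec_opp => vV /(h v vV).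
by rewrite !inE => /or4P[] -> ; rewrite ?orbT.
Qed.

Lemma parallelogram_turn a b c :
  parallelogram a b c -> parallelogram c (add (add a b) (opp c)) a.
Proof.
move=> [abc dV h]; have [D aV bV cV abcV] := facet_tripleP _ _ _ _ abc.
split; rewrite ?add_opp_opp2 //.
  apply/facet_tripleP; rewrite facet_vec_opp2 det_opp2.
  by split=> // [|v /abcV]; lia.
move=> v; rewrite facet_vec_opp2 => vV /(h v vV).
by rewrite !inE => /or4P[] -> ; rewrite ?orbT.
Qed.

Lemma det_two_opp a b c :
  det (add (add a b) (opp c)) (add (add b c) (opp a)) a = 2 * det a b c.
Proof. move: a b c; ptring. Qed.

Lemma facet_vec_two_opp a b c :
  facet_vec (add (add a b) (opp c)) (add (add b c) (opp a)) a =
  scale 4 (facet_vec a b c).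
Proof. move: a b c; ptring. Qed.

(** Two fourth vertices on the same facet would span, together with [a], a
    triple of determinant 2. *)
Lemma not_two_opp a b c :
  facet_triple V a b c -> add (add a b) (opp c) \in V ->
  add (add b c) (opp a) \in V -> False.
Proof.
move=> abc d1 d2; have D := facet_det abc.
have [? aV bV cV abcV] := facet_tripleP _ _ _ _ abc.
suff: facet_triple V (add (add a b) (opp c)) (add (add b c) (opp a)) a.
  by move/facet_det; rewrite det_two_opp; lia.
apply/facet_tripleP; rewrite det_two_opp; split => // [|v /abcV]; first lia.
by rewrite facet_vec_two_opp dot_scale; lia.
Qed.

Lemma facet_shape a b c : facet_triple V a b c ->
  [\/ triangle a b c, parallelogram a b c, parallelogram b c a |
      parallelogram c a b].
Proof.
move=> abc; have bca := facet_triple_cyc abc; have cab := facet_triple_cyc bca.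
have cases v := @facet_point_cases a b c v abc.
have n1 := not_two_opp abc; have n2 := not_two_opp bca.
have n3 := not_two_opp cab.
have [d1|d1] := boolP (add (add a b) (opp c) \in V).
  constructor 2; split=> // v vV hv; case: (cases v vV hv) => [|->|E|E].
  - by rewrite !inE => /or3P[] ->; rewrite ?orbT.
  - by rewrite !inE eqxx !orbT.
  - by case: (n1 d1); rewrite -E.
  - by case: (n3 _ d1); rewrite -E.
have [d2|d2] := boolP (add (add b c) (opp a) \in V).
  constructor 3; split=> // v vV; rewrite facet_vec_cyc => hv.
  case: (cases v vV hv) => [|E|->|E].
  - by rewrite !inE => /or3P[] ->; rewrite ?orbT.
  - by case: (negP d1); rewrite -E.
  - by rewrite !inE eqxx !orbT.
  - by case: (n2 d2); rewrite -E.
have [d3|d3] := boolP (add (add c a) (opp b) \in V).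
  constructor 4; split=> // v vV; rewrite -facet_vec_cyc => hv.
  case: (cases v vV hv) => [|E|E|->].
  - by rewrite !inE => /or3P[] ->; rewrite ?orbT.
  - by case: (negP d1); rewrite -E.
  - by case: (negP d2); rewrite -E.
  - by rewrite !inE eqxx !orbT.
constructor 1; split=> // v vV hv; case: (cases v vV hv) => // E.
- by case: (negP d1); rewrite -E.
- by case: (negP d2); rewrite -E.
- by case: (negP d3); rewrite -E.
Qed.

Definition facet_triples : seq (pt * pt * pt) :=
  [seq t <- [seq (p, w) | p <- [seq (u, v) | u <- V, v <- V], w <- V]
  | facet_triple V t.1.1 t.1.2 t.2].

Lemma mem_facet_triples u v w :
  ((u, v, w) \in facet_triples) = facet_triple V u v w.
Proof.
rewrite mem_filter andb_idr //= => uvw.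
have [_ uV vV wV _] := facet_tripleP _ _ _ _ uvw.
by apply: allpairs_f => //; apply: allpairs_f.
Qed.

Lemma seq_argmin (T : eqType) (le : rel T) (s : seq T) :
  s != [::] ->
  {in s &, forall x y, le x y || le y x} ->
  {in s & &, forall y x z, le x y -> le y z -> le x z} ->
  exists2 x, x \in s & forall y, y \in s -> le x y.
Proof.
elim: s => // x [|y s] IH _ tot tr.
  exists x; rewrite ?mem_head // => y; rewrite inE => /eqP ->.
  by have := tot x x; rewrite mem_head orbb; apply.
have [||z zs zmin] := IH isT.
- by move=> u v us vs; apply: tot; rewrite inE (us, vs) orbT.
- by move=> u v w us vs ws; apply: tr; rewrite inE (us, vs, ws) orbT.
have xs : x \in x :: y :: s by rewrite mem_head.
have zs' : z \in x :: y :: s by rewrite inE zs orbT.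
have /orP[xz|zx] := tot x z xs zs'.
  exists x => // w; rewrite inE => /predU1P[->|ws].
    by have := tot x x xs xs; rewrite orbb.
  by apply: (tr z) (zmin _ ws); rewrite // inE ws orbT.
by exists z => // w; rewrite inE => /predU1P[->|/zmin].
Qed.

(** Rotate the plane of the facet about the edge [b c]. Among the vertices [v]
    behind the edge, the first one reached is the [w] that minimises the ratio
    of the depth [g v] of [v] below the plane to minus its [a]-coordinate [f v].
    Unimodularity of the new facet makes [f w] equal to [-1], so that the slope
    [t] of the rotation is an integer. *)
Lemma facet_across a b c :
  facet_triple V a b c ->
  (forall v, v \in V -> dot v (facet_vec a b c) = 1 ->
    0 <= dot v (dual_vec a b c)) ->
  exists w t, [/\ facet_triple V w b c, 0 < t &
    facet_vec w b c = add (facet_vec a b c) (scale (- t) (dual_vec a b c))].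
Proof.
move=> abc edge; have D := facet_det abc.
have [_ aV bV cV abcV] := facet_tripleP _ _ _ _ abc.
have hV v : v \in V -> dot v (facet_vec a b c) <= 1.
  exact: facet_le1 abc.
pose f v := dot v (dual_vec a b c); pose g v := 1 - dot v (facet_vec a b c).
pose N := [seq v <- V | f v <? 0].
have memN v : v \in N -> v \in V /\ f v < 0.
  by rewrite mem_filter => /andP[+ ->]; split=> //; lia.
have N0 : N != [::].
  have [_ [v vV fv]] := V_unimodular abc.
  have : v \in N by rewrite mem_filter vV andbT /f; lia.
  by apply: contraTneq => ->.
pose le v w := g v * - f w <=? g w * - f v.
have [||w /memN[wV fw] wmin] := @seq_argmin _ le N N0.
- by move=> v w _ _; rewrite /le; lia.
- move=> w v u /memN[/hV gw fw] /memN[/hV gv fv] /memN[/hV gu fu].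
  rewrite /le -!/(f _) => h1 h2.
  suff : (g v * - f u) * - f w <= (g u * - f v) * - f w by nia.
  have i1 : (g v * - f w) * - f u <= (g w * - f v) * - f u by nia.
  have i2 : (g w * - f u) * - f v <= (g u * - f w) * - f v by nia.
  by nia.
have Dw : det w b c = f w * det a b c.
  by rewrite -{1}(frame_coords w D) det_frame_fst /=; rewrite /f; ring.
have hw := hV _ wV; have gw : 0 <= g w by rewrite /g; lia.
have hvec : facet_vec w b c = scale (f w)
    (add (scale (g w + f w) (dual_vec a b c))
         (scale (f w) (add (facet_vec a b c) (scale (-1) (dual_vec a b c))))).
  rewrite -{1}(frame_coords w D) /coords facet_vec_frame_fst -/(f w).
  have -> : g w + f w =
      1 - dot w (dual_vec b c a) - dot w (dual_vec c a b).
    by rewrite /g dot_facet_coords /coords -/(f w) /=; ring.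
  congr (scale _ (add _ (scale _ _))).
  by rewrite /facet_vec; move: (dual_vec _ _ _) (dual_vec _ _ _)
    (dual_vec _ _ _); ptring.
have hdot u : dot u (facet_vec w b c) = f w * ((g w + f w) * f u +
    f w * (dot u (facet_vec a b c) - f u)).
  rewrite hvec; move: (g w) (f w) => x y; rewrite /f.
  by move: u (dual_vec a b c) (facet_vec a b c); clear; ptring.
have wbc : facet_triple V w b c.
  apply/facet_tripleP; rewrite Dw; split=> // [|v vV]; first by nia.
  rewrite hdot.
  have gv : 0 <= g v by rewrite /g; have := hV _ vV; lia.
  have -> : dot v (facet_vec a b c) = 1 - g v by rewrite /g; lia.
  suff : 0 <= g v * - f w + f v * g w by nia.
  have [fv|fv] := Z_lt_le_dec (f v) 0; last by nia.
  have vN : v \in N by rewrite mem_filter vV andbT; lia.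
  by have := wmin _ vN; rewrite /le; lia.
have fw1 : f w = -1 by have := facet_det wbc; rewrite Dw; nia.
exists w, (g w); split=> //.
  suff : g w <> 0 by lia.
  by move=> g0; have := edge _ wV; rewrite -/(f w) /g in g0 *; lia.
rewrite hvec fw1; move: (g w) => t.
by move: (facet_vec a b c) (dual_vec a b c); clear; ptring.
Qed.

(** The vertex [v] lies below the facet across the edge [b c], which is rotated
    by a slope of at least [1]. *)
Lemma coord_lower_bound a b c v :
  facet_triple V a b c ->
  (forall v, v \in V -> dot v (facet_vec a b c) = 1 ->
    0 <= dot v (dual_vec a b c)) ->
  v \in V -> dot v (facet_vec a b c) - 1 <= dot v (dual_vec a b c).
Proof.
move=> abc edge vV; have [w [t [wbc t0 E]]] := facet_across abc edge.
have := facet_le1 wbc vV; have := facet_le1 abc vV.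
rewrite E dot_add dot_scale; nia.
Qed.

(** If the plane of the facet is the one on which [s] is highest, then [s] is on
    the inner side of each edge, as otherwise rotating the plane about the edge
    to the next facet would raise [s]. *)
Lemma coord_ge0_special a b c s :
  facet_triple V a b c ->
  (forall v, v \in V -> dot v (facet_vec a b c) = 1 ->
    0 <= dot v (dual_vec a b c)) ->
  (forall x y z, facet_triple V x y z ->
    dot s (facet_vec x y z) <= dot s (facet_vec a b c)) ->
  0 <= dot s (dual_vec a b c).
Proof.
move=> abc edge smax; have [w [t [wbc t0 E]]] := facet_across abc edge.
have := smax _ _ _ wbc; rewrite E dot_add dot_scale; nia.
Qed.

Lemma dot_dual_cyc a b c : dot b (dual_vec a b c) = 0.
Proof. move: a b c; ptring. Qed.

Lemma dot_dual_last a b c : dot c (dual_vec a b c) = 0.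
Proof. move: a b c; ptring. Qed.

Lemma dot_dual_fst a b c : dot a (dual_vec a b c) = det a b c * det a b c.
Proof. move: a b c; ptring. Qed.

Lemma triangle_edge a b c : triangle a b c ->
  forall v, v \in V -> dot v (facet_vec a b c) = 1 ->
    0 <= dot v (dual_vec a b c).
Proof.
move=> [/facet_det D h] v vV /(h v vV); rewrite !inE => /or3P[] /eqP ->.
- by rewrite dot_dual_fst D.
- by rewrite dot_dual_cyc.
- by rewrite dot_dual_last.
Qed.

Lemma parallelogram_edge a b c : parallelogram a b c ->
  forall v, v \in V -> dot v (facet_vec a b c) = 1 ->
    0 <= dot v (dual_vec a b c).
Proof.
move=> [/facet_det D _ h] v vV /(h v vV).
rewrite !inE => /or4P[] /eqP ->; rewrite ?dot_addl ?dot_scalel;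
  by rewrite ?dot_dual_fst ?dot_dual_cyc ?dot_dual_last ?D.
Qed.

Lemma dual_vec_opp a b c :
  dual_vec a b (add (add a b) (opp c)) =
  add (dual_vec a b c) (dual_vec c a b).
Proof. move: a b c; ptring. Qed.

End UnimodularHull.

(** * The search *)

(** In a terminal polytope the midpoint of two lattice points congruent modulo 2
    is again a lattice point, but not a vertex, so it is the origin. *)
Definition parity_free (V : seq pt) : Prop :=
  (forall a m, a \in V -> a <> add m m) /\
  (forall a b m, a \in V -> b \in V -> add a b = add m m ->
     a = b \/ b = opp a).

Definition congr2 (a b : pt) : bool :=
  let: (x, y, z) := add a b in [&& Z.even x, Z.even y & Z.even z].

Definition compat (a b : pt) : bool := congr2 a b ==> (b == opp a).

(** Minus the height: the facet spanned by the standard basis is at level [-1],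
    and the level of the remaining vertices is at least [0]. *)
Definition level (x : pt) : Z := let: (x1, x2, x3) := x in - (x1 + x2 + x3).

(** Tests [P] on every extension of [chosen] by pairwise compatible points of
    [rest] of total level at most [budget]. The number [n] only bounds the depth
    of the recursion, which is on filtered lists. *)
Fixpoint search (P : seq pt -> bool) n (chosen rest : seq pt) budget : bool :=
  if rest is x :: r then
    if n is n'.+1 then
      search P n' chosen r budget &&
      ((level x <=? budget) ==>
       search P n' (x :: chosen) [seq y <- r | compat x y] (budget - level x))
    else false
  else P chosen.

Definition interval6 : seq Z :=
  [:: -6; -5; -4; -3; -2; -1; 0; 1; 2; 3; 4; 5; 6].

Definition cube : seq pt :=
  [seq (p, z) | p <- [seq (x, y) | x <- interval6, y <- interval6],
                z <- interval6].

(** The points that [coord_lower_bound] leaves for the vertices outside a facet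
    with vertices [base]; the forms in [edges] are nonnegative on the facet and
    vanish on one edge each. Points of positive level come first, so that the
    budget of the search runs out early. *)
Definition candidates (base edges : seq pt) : seq pt :=
  let s := [seq x <- cube | [&& 0 <=? level x,
              level x <=? Z.of_nat (size base),
              all (fun f => - level x - 1 <=? dot x f) edges,
              ~~ congr2 x (0, 0, 0) & all (compat x) base]] in
  [seq x <- s | 0 <? level x] ++ [seq x <- s | level x =? 0].

Definition base3 : seq pt := [:: e1; e2; e3].
Definition base4 : seq pt := [:: e1; e2; e3; (1, 1, -1)].
Definition edges3 : seq pt := [:: e1; e2; e3].
Definition edges4 : seq pt := [:: e1; e2; (1, 0, 1); (0, 1, 1)].

Lemma congr2P a b : reflect (exists m, add a b = add m m) (congr2 a b).
Proof.
rewrite /congr2; case: (add a b) => [[x y] z].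
apply: (iffP and3P) => [[/Z.even_spec[i ->] /Z.even_spec[j ->]]|].
  by move=> /Z.even_spec[k ->]; exists (i, j, k) => /=; congr (_, _, _); lia.
move=> [[[i j] k] [-> -> ->]].
by rewrite !Z.add_diag !Z.even_mul.
Qed.

Lemma vsum_cat s t : vsum (s ++ t) = add (vsum s) (vsum t).
Proof.
elim: s => [|x s IH] /=; first by move: (vsum t); ptring.
by rewrite IH; move: x (vsum s) (vsum t); clear; ptring.
Qed.

Lemma perm_vsum s t : perm_eq s t -> vsum s = vsum t.
Proof.
move=> st.
apply: (catCA_perm_ind (P := fun u => vsum s = vsum u) _ st) => // x y z ->.
rewrite !vsum_cat; move: (vsum x) (vsum y) (vsum z); clear; ptring.
Qed.

Lemma vsum_coords a b c s :
  vsum [seq coords a b c v | v <- s] = coords a b c (vsum s).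
Proof.
elim: s => [|x s /= ->]; first by move: a b c; ptring.
by rewrite coords_add.
Qed.

Lemma level_dot x : level x = dot (-1, -1, -1) x.
Proof. by move: x; rewrite /level; ptring. Qed.

Lemma level_add x y : level (add x y) = level x + level y.
Proof. by rewrite !level_dot dot_add. Qed.

Lemma level_vsum_ge0 s :
  (forall x, x \in s -> 0 <= level x) -> 0 <= level (vsum s).
Proof.
elim: s => //= x s IH h; rewrite level_add.
have := h x (mem_head _ _).
by have := IH (fun y ys => h y (mem_behead (s := x :: s) ys)); lia.
Qed.

Lemma level_le_vsum s x :
  (forall x, x \in s -> 0 <= level x) -> x \in s -> level x <= level (vsum s).
Proof.
elim: s => //= y s IH h; rewrite level_add inE => /predU1P[->|xs].
  have := @level_vsum_ge0 s (fun z zs => h z (mem_behead (s := _ :: s) zs)).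
  by lia.
have := h y (mem_head _ _).
by have := IH (fun y ys => h y (mem_behead (s := _ :: s) ys)) xs; lia.
Qed.

Lemma search_sound P n chosen rest budget X :
  search P n chosen rest budget ->
  (forall x, x \in rest -> 0 <= level x) ->
  subseq X rest -> pairwise compat X -> level (vsum X) <= budget ->
  P (catrev X chosen).
Proof.
elim: n chosen rest budget X => [|n IH] chosen [|x r] budget X //=.
- by move=> Pc _ /eqP ->.
- by move=> Pc _ /eqP ->.
move=> /andP[skip take] lev0.
have lev_r y : y \in r -> 0 <= level y.
  by move=> yr; apply: lev0; rewrite inE yr orbT.
case: X => [_ _|y X] /=.
  by apply: (IH _ _ _ [::] skip) => //; exact: sub0seq.
case: eqP => [-> sX /andP[xX cX] bX|_ sX cX bX]; last first.
  exact: (IH _ _ _ (y :: X) skip).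
have levX z : z \in X -> 0 <= level z by move=> /(mem_subseq sX)/lev_r.
rewrite level_add in bX; have := level_vsum_ge0 levX => X0.
have lex : level x <=? budget by lia.
move: take; rewrite lex /= => take.
apply: (IH _ _ _ X take) => // [z||]; last by lia.
  by rewrite mem_filter => /andP[_ /lev_r].
by rewrite subseq_filter xX.
Qed.

Definition unimodular_hullb (V : seq pt) : bool :=
  all (fun a => all (fun b => all (fun c => supporting V a b c ==>
    (det a b c * det a b c == 1) &&
    has (fun v => dot v (dual_vec a b c) <? 0) V) V) V) V.

Lemma unimodular_hullP V : reflect (unimodular_hull V) (unimodular_hullb V).
Proof.
apply: (iffP idP) => [h a b c abc|h].
  have [_ aV bV cV _] := facet_tripleP _ _ _ _ abc.
  have /and4P[_ _ _ sup] := abc.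
  move/allP/(_ a aV)/allP/(_ b bV)/allP/(_ c cV): h; rewrite sup /=.
  by move=> /andP[/eqP-> /hasP[v vV ?]]; split=> //; exists v => //; lia.
apply/allP => a aV; apply/allP => b bV; apply/allP => c cV.
apply/implyP => abc; have [|-> [v vV ?]] := h a b c; first exact/and4P.
by rewrite eqxx /=; apply/hasP; exists v => //; lia.
Qed.

(** The symmetric matrix of the form [v |-> sum_(x, y in V) det v x y ^ 2], a form
    that unimodular maps carry along with [V]. *)
Definition inertia (V : seq pt) : pt * pt * pt :=
  let N := [seq cross a b | a <- V, b <- V] in
  let row (k : pt -> Z) := vsum [seq scale (k n) n | n <- N] in
  (row (fun n => n.1.1), row (fun n => n.1.2), row (fun n => n.2)).

Definition inertia_form (M : pt * pt * pt) (v w : pt) : Z :=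
  dot v (dot w M.1.1, dot w M.1.2, dot w M.2).

Definition zsum : seq Z -> Z := foldr Z.add 0.

(** Both numbers are unchanged by lattice isomorphisms. That they separate the
    polytopes of the classification is found by computing them. *)
Definition invariant (V : seq pt) : Z * Z :=
  let M := inertia V in let s := vsum V in
  (zsum [seq inertia_form M v v | v <- V],
   zsum [seq (let q := inertia_form M v s in q * q * q) | v <- V]).

(** Some unimodular triple of [L] serves as a basis in which [L] becomes part of
    [V]. *)
Definition has_view (L V : seq pt) : bool :=
  has (fun a => has (fun b => has (fun c => (det a b c * det a b c == 1) &&
    all (fun v => coords a b c v \in V) L) L) L) L.

(** Comparing invariants first leaves at most one candidate for the costly
    test. *)
Definition matched (table : seq (Z * Z * seq pt)) (V : seq pt) : bool :=
  let i := invariant V in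
  has (fun t => [&& t.1 == i, size t.2 == size V & has_view t.2 V]) table.

(** Normalisations of the sum of [V] that the symmetries of a triangle, and those
    of a parallelogram with diagonal [e1 e2], make possible. *)
Definition sorted3 (V : seq pt) : bool :=
  let: (s1, s2, s3) := vsum V in [&& s2 <=? s1, s3 <=? s2 & 0 <=? s3].

Definition sorted4 (V : seq pt) : bool :=
  let: (s1, s2, s3) := vsum V in
  [&& s2 + s3 <=? s1, 0 <=? s2 & 0 <=? s3].

Definition leaf table (sorted : seq pt -> bool) (V : seq pt) : bool :=
  sorted V ==> unimodular_hullb V ==> matched table V.

Definition full_search (C base : seq pt) table sorted : bool :=
  search (leaf table sorted) (size C) base C (Z.of_nat (size base)).

(** All polytopes on the list have the standard basis as a facet triple; only
    the other vertices are listed. *)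
Definition representatives : seq (seq pt) := [seq base3 ++ r | r <- [::
  [:: (-1, -1, -1)];
  [:: (2, -1, -1); (-1, 0, 0)];
  [:: (1, 1, -1); (-1, -1, 0)];
  [:: (1, 0, -1); (-1, -1, 0)];
  [:: (1, -1, -1); (-1, 0, 0)];
  [:: (0, 0, -1); (-1, -1, 0)];
  [:: (2, -1, -1); (-1, 1, 0); (-1, 0, 0)];
  [:: (1, 1, -1); (1, -1, 0); (-1, 0, 0)];
  [:: (1, 1, -1); (0, -1, 0); (-1, 0, 0)];
  [:: (1, 0, -1); (1, -1, 0); (-1, 0, 0)];
  [:: (1, 0, -1); (0, 1, -1); (-1, -1, 1)];
  [:: (1, 0, -1); (0, 0, -1); (-1, -1, 1)];
  [:: (1, 0, -1); (0, -1, 0); (-1, 0, 0)];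
  [:: (1, 0, -1); (-1, 0, 0); (-1, -1, 0)];
  [:: (1, -1, 0); (0, 1, -1); (-1, 0, 0)];
  [:: (1, -1, -1); (0, 0, -1); (-1, 0, 1)];
  [:: (0, 0, -1); (0, -1, 0); (-1, 0, 0)];
  [:: (2, -1, -1); (1, -1, -1); (-1, 1, 0); (-1, 0, 1)];
  [:: (1, 1, -1); (1, 0, -1); (0, 0, -1); (-1, -1, 2)];
  [:: (1, 1, -1); (1, 0, -1); (0, -1, 1); (-1, 0, 0)];
  [:: (1, 1, -1); (1, 0, -1); (-1, 0, 1); (-1, -1, 0)];
  [:: (1, 1, -1); (1, -1, 0); (0, -1, 1); (-1, 0, 0)];
  [:: (1, 1, -1); (1, -1, 0); (0, -1, 0); (-1, 1, 0)];
  [:: (1, 1, -1); (1, -1, 0); (0, -1, 0); (-1, 0, 0)];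
  [:: (1, 1, -1); (0, 0, -1); (0, -1, 1); (-1, 0, 0)];
  [:: (1, 1, -1); (0, 0, -1); (0, -1, 0); (-1, -1, 1)];
  [:: (1, 0, -1); (1, -1, 0); (0, 0, -1); (-1, 0, 1)];
  [:: (1, 0, -1); (1, -1, 0); (-1, 1, 0); (-1, 0, 0)];
  [:: (1, 0, -1); (0, 1, -1); (0, 0, -1); (-1, -1, 2)];
  [:: (1, 0, -1); (0, 1, -1); (0, -1, 1); (-1, 0, 0)];
  [:: (1, 0, -1); (0, 1, -1); (0, -1, 0); (-1, -1, 1)];
  [:: (1, 0, -1); (0, 0, -1); (0, -1, 0); (-1, 0, 1)];
  [:: (1, 0, -1); (0, 0, -1); (-1, 0, 1); (-1, -1, 0)];
  [:: (1, -1, 0); (0, 1, -1); (0, 0, -1); (-1, 0, 1)];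
  [:: (1, -1, 0); (0, 1, -1); (0, -1, 0); (-1, 0, 0)];
  [:: (2, -1, -1); (1, -1, -1); (-1, 1, 0); (-1, 0, 1); (-1, 0, 0)];
  [:: (1, 1, -1); (1, 1, -2); (0, 0, -1); (0, -1, 1); (-1, -1, 2)];
  [:: (1, 1, -1); (1, 0, -1); (1, -1, 0); (0, -1, 1); (-1, 0, 0)];
  [:: (1, 1, -1); (1, 0, -1); (1, -1, 0); (-1, 0, 1); (-1, 0, 0)];
  [:: (1, 1, -1); (1, 0, -1); (0, 0, -1); (0, -1, 1); (-1, 0, 1)];
  [:: (1, 1, -1); (1, 0, -1); (0, 0, -1); (0, -1, 1); (-1, -1, 2)];
  [:: (1, 1, -1); (1, 0, -1); (0, -1, 1); (0, -1, 0); (-1, 1, 0)];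
  [:: (1, 1, -1); (1, 0, -1); (0, -1, 0); (-1, 0, 1); (-1, 0, 0)];
  [:: (1, 1, -1); (1, -1, 0); (0, 1, -1); (0, -1, 0); (-1, 0, 1)];
  [:: (1, 1, -1); (1, -1, 0); (0, -1, 1); (0, -1, 0); (-1, 1, 0)];
  [:: (1, 1, -1); (1, -1, 0); (0, -1, 0); (-1, 1, 0); (-1, 0, 0)];
  [:: (1, 1, -1); (1, -1, 0); (0, -1, 0); (-1, 0, 1); (-1, 0, 0)];
  [:: (1, 1, -1); (0, 0, -1); (0, -1, 0); (-1, 0, 0); (-1, -1, 1)];
  [:: (1, 0, -1); (1, -1, 0); (0, 1, -1); (0, -1, 1); (-1, 0, 0)];
  [:: (1, 0, -1); (1, -1, 0); (0, 1, -1); (0, -1, 0); (-1, 0, 1)];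
  [:: (1, 0, -1); (1, -1, 0); (0, 1, -1); (-1, 0, 1); (-1, 0, 0)];
  [:: (1, 0, -1); (1, -1, 0); (0, 0, -1); (-1, 1, 0); (-1, 0, 1)];
  [:: (1, 0, -1); (1, -1, 0); (0, 0, -1); (-1, 0, 1); (-1, 0, 0)];
  [:: (1, 0, -1); (0, 1, -1); (0, 0, -1); (0, -1, 1); (-1, 0, 1)];
  [:: (1, 0, -1); (0, 1, -1); (0, -1, 1); (0, -1, 0); (-1, 0, 0)];
  [:: (1, 0, -1); (0, 1, -1); (0, -1, 0); (-1, 0, 0); (-1, -1, 1)];
  [:: (1, 0, -1); (0, 0, -1); (0, -1, 0); (-1, 0, 1); (-1, 0, 0)];
  [:: (1, -1, 0); (0, 1, -1); (0, 0, -1); (0, -1, 0); (-1, 0, 1)];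
  [:: (1, 1, -1); (1, 0, -1); (1, -1, 0); (0, 0, -1); (0, -1, 1); (-1, 0, 1)];
  [:: (1, 1, -1); (1, 0, -1); (1, -1, 0); (0, -1, 1); (-1, 1, 0); (-1, 0, 0)];
  [:: (1, 1, -1); (1, 0, -1); (1, -1, 0); (0, -1, 1); (-1, 0, 1); (-1, 0, 0)];
  [:: (1, 1, -1); (1, 0, -1); (1, -1, 0); (0, -1, 0); (-1, 1, 0); (-1, 0, 1)];
  [:: (1, 1, -1); (1, 0, -1); (1, -1, 0); (0, -1, 0); (-1, 0, 1); (-1, 0, 0)];
  [:: (1, 1, -1); (1, 0, -1); (0, 1, -1); (0, 0, -1); (0, -1, 1); (-1, -1, 2)];
  [:: (1, 1, -1); (1, 0, -1); (0, 1, -1); (0, -1, 1); (0, -1, 0); (-1, 0, 1)];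
  [:: (1, 1, -1); (1, 0, -1); (0, 1, -1); (0, -1, 1); (0, -1, 0); (-1, -1, 2)];
  [:: (1, 1, -1); (1, 0, -1); (0, 0, -1); (0, -1, 1); (-1, 0, 1); (-1, 0, 0)];
  [:: (1, 1, -1); (1, -1, 0); (0, 1, -1); (0, -1, 1); (0, -1, 0); (-1, 0, 1)];
  [:: (1, 1, -1); (1, -1, 0); (0, 1, -1); (0, -1, 0); (-1, 0, 1); (-1, 0, 0)];
  [:: (1, 1, -1); (1, -1, 0); (0, -1, 1); (0, -1, 0); (-1, 1, 0); (-1, 0, 0)];
  [:: (1, 0, -1); (1, -1, 0); (0, 1, -1); (0, 0, -1); (0, -1, 1); (-1, 0, 1)];
  [:: (1, 0, -1); (1, -1, 0); (0, 1, -1); (0, -1, 1); (-1, 1, 0); (-1, 0, 0)];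
  [:: (1, 0, -1); (1, -1, 0); (0, 1, -1); (0, -1, 0); (-1, 0, 1); (-1, 0, 0)];
  [:: (1, 0, -1); (1, -1, 0); (0, 0, -1); (0, -1, 0); (-1, 1, 0); (-1, 0, 1)];
  [:: (1, 0, -1); (0, 1, -1); (0, 0, -1); (0, -1, 1); (0, -1, 0); (-1, 0, 1)];
  [:: (1, -1, 0); (0, 1, -1); (0, 0, -1); (0, -1, 0); (-1, 0, 1); (-1, 0, 0)];
  [:: (1, 1, -1); (1, 1, -2); (1, 0, -1); (0, 0, -1); (0, -1, 1); (-1, 0, 1);
      (-1, -1, 2)];
  [:: (1, 1, -1); (1, 1, -2); (1, 0, -1); (0, -1, 1); (0, -1, 0); (-1, 0, 1);
      (-1, -1, 2)];
  [:: (1, 1, -1); (1, 0, -1); (1, -1, 0); (0, 1, -1); (0, -1, 1); (0, -1, 0);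
      (-1, 0, 1)];
  [:: (1, 1, -1); (1, 0, -1); (1, -1, 0); (0, 1, -1); (0, -1, 1); (-1, 0, 1);
      (-1, 0, 0)];
  [:: (1, 1, -1); (1, 0, -1); (1, -1, 0); (0, 0, -1); (0, -1, 1); (-1, 0, 1);
      (-1, 0, 0)];
  [:: (1, 1, -1); (1, 0, -1); (1, -1, 0); (0, -1, 1); (0, -1, 0); (-1, 1, 0);
      (-1, 0, 1)];
  [:: (1, 1, -1); (1, 0, -1); (1, -1, 0); (0, -1, 0); (-1, 1, 0); (-1, 0, 1);
      (-1, 0, 0)];
  [:: (1, 1, -1); (1, 0, -1); (0, 1, -1); (0, -1, 1); (0, -1, 0); (-1, 0, 1);
      (-1, 0, 0)];
  [:: (1, 1, -1); (1, -1, 0); (0, 1, -1); (0, -1, 1); (0, -1, 0); (-1, 0, 1);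
      (-1, 0, 0)];
  [:: (1, 0, -1); (1, -1, 0); (1, -1, -1); (0, 1, -1); (0, -1, 1); (-1, 1, 0);
      (-1, 0, 1)];
  [:: (1, 0, -1); (1, -1, 0); (0, 1, -1); (0, 0, -1); (0, -1, 1); (-1, 1, 0);
      (-1, 0, 1)];
  [:: (1, 0, -1); (1, -1, 0); (0, 1, -1); (0, 0, -1); (0, -1, 1); (-1, 0, 1);
      (-1, 0, 0)];
  [:: (1, 0, -1); (1, -1, 0); (0, 0, -1); (0, -1, 0); (-1, 1, 0); (-1, 0, 1);
      (-1, 0, 0)];
  [:: (1, 1, -1); (1, 1, -2); (1, 0, -1); (0, 1, -1); (0, -1, 1); (0, -1, 0);
      (-1, 0, 1); (-1, -1, 2)];
  [:: (1, 1, -1); (1, 1, -2); (1, 0, -1); (0, 0, -1); (0, -1, 1); (0, -1, 0);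
      (-1, 0, 1); (-1, -1, 2)];
  [:: (1, 1, -1); (1, 0, -1); (1, -1, 0); (0, 1, -1); (0, -1, 1); (0, -1, 0);
      (-1, 1, 0); (-1, 0, 1)];
  [:: (1, 1, -1); (1, 0, -1); (1, -1, 0); (0, 1, -1); (0, -1, 1); (0, -1, 0);
      (-1, 0, 1); (-1, 0, 0)];
  [:: (1, 1, -1); (1, 0, -1); (1, -1, 0); (0, -1, 1); (0, -1, 0); (-1, 1, 0);
      (-1, 0, 1); (-1, 0, 0)];
  [:: (1, 0, -1); (1, -1, 0); (0, 1, -1); (0, 0, -1); (0, -1, 1); (0, -1, 0);
      (-1, 1, 0); (-1, 0, 1)];
  [:: (1, 1, -1); (1, 0, -1); (1, -1, 0); (0, 1, -1); (0, -1, 1); (0, -1, 0);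
      (-1, 1, 0); (-1, 0, 1); (-1, 0, 0)];
  [:: (1, 1, -1); (1, 0, -1); (1, -1, 0); (0, 1, -1); (0, -1, 1); (0, -1, 0);
      (-1, 1, 0); (-1, 0, 1); (-1, -1, 1)];
  [:: (1, 0, -1); (1, -1, 0); (0, 1, -1); (0, 0, -1); (0, -1, 1); (0, -1, 0);
      (-1, 1, 0); (-1, 0, 1); (-1, 0, 0)];
  [:: (1, 1, -1); (1, 1, -2); (1, 0, -1); (0, 1, -1); (0, 0, -1); (0, -1, 1);
      (0, -1, 0); (-1, 0, 1); (-1, -1, 2); (-1, -1, 1)];
  [:: (1, 1, -1); (1, 0, -1); (1, -1, 0); (0, 1, -1); (0, 0, -1); (0, -1, 1);
      (0, -1, 0); (-1, 1, 0); (-1, 0, 1); (-1, 0, 0); (-1, -1, 1)]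
]].

Definition rep_table := [seq (invariant L, L) | L <- representatives].

(** The two searches are decided by computation; each of them visits about ten
    thousand sets. *)
Lemma full_search_triangle :
  full_search (candidates base3 edges3) base3 rep_table sorted3.
Proof. by lazy. Qed.

Lemma full_search_parallelogram :
  full_search (candidates base4 edges4) base4 rep_table sorted4.
Proof. by lazy. Qed.

Lemma uniq_representatives : all uniq representatives.
Proof. by []. Qed.

Lemma uniq_cube : uniq cube.
Proof.
by apply: allpairs_uniq => // [[p z] [q w] _ _ /= [-> ->]].
Qed.

Lemma uniq_candidates base edges : uniq (candidates base edges).
Proof.
rewrite /candidates; move: cube uniq_cube => s us.
rewrite cat_uniq !filter_uniq // andbT /=.
by apply/hasPn => x; rewrite !mem_filter => /andP[lx _]; lia.
Qed.

Lemma mem_candidates base edges x :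
  (x \in candidates base edges) =
  [&& 0 <=? level x, level x <=? Z.of_nat (size base),
     all (fun f => - level x - 1 <=? dot x f) edges,
     ~~ congr2 x (0, 0, 0), all (compat x) base & x \in cube].
Proof.
rewrite /candidates; move: cube => s; rewrite mem_cat !mem_filter.
have -> : (0 <=? level x) = (0 <? level x) || (level x =? 0) by lia.
by case: (_ <? _); case: (_ =? _); case: (x \in s);
  rewrite /= ?(andbF, andbT) ?orbb ?orbF.
Qed.

Lemma pairwise_uniq_in (T : eqType) (r : rel T) (s : seq T) :
  uniq s -> {in s &, forall x y, x != y -> r x y} -> pairwise r s.
Proof.
elim: s => //= x s IH /andP[xs us] h; apply/andP; split.
  apply/allP => y ys; apply: h; rewrite ?mem_head // ?inE ?ys ?orbT //.
  by apply: contraNneq xs => ->.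
by apply: IH => // y z ys zs; apply: h; rewrite inE (ys, zs) orbT.
Qed.

Lemma coords_inj a b c : det a b c * det a b c = 1 -> injective (coords a b c).
Proof. by move=> D x y E; rewrite -(frame_coords x D) E frame_coords. Qed.

Definition isomorphic_pts (V L : seq pt) : Prop :=
  exists a b c a' b' c', [/\ det a b c * det a b c = 1,
    det a' b' c' * det a' b' c' = 1 &
    [seq coords a b c v | v <- V] =i [seq coords a' b' c' v | v <- L]].

Lemma dot_dual_det a b c v :
  dot v (dual_vec a b c) = det a b c * det v b c.
Proof. move: a b c v; ptring. Qed.

Lemma unimodular_hull_coords V a b c :
  det a b c * det a b c = 1 -> unimodular_hull V ->
  unimodular_hull [seq coords a b c v | v <- V].
Proof.
move=> D hV x y z /facet_tripleP[xyz0 xW yW zW le].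
pose F := frame a b c.
have FW v : v \in [seq coords a b c v | v <- V] -> F v \in V.
  by move=> /mapP[w wV ->]; rewrite /F frame_coords.
have dF u v w : det (F u) (F v) (F w) = det a b c * det u v w by exact: det_frame.
have [|E [v vV vlt]] := hV (F x) (F y) (F z).
  apply/facet_tripleP; rewrite dF.
  split; [by move/Z.mul_eq_0 => []; lia|exact: FW..|] => v vV.
  have := le _ (map_f _ vV); rewrite !dot_facet_det dF.
  rewrite -(frame_coords v D) -/(F _) !dF (coords_frame _ D); nia.
split; first by move: E; rewrite dF; nia.
exists (coords a b c v); first exact: map_f.
move: vlt; rewrite !dot_dual_det dF.
have -> : det v (F y) (F z) = det a b c * det (coords a b c v) y z.
  by rewrite -dF /F frame_coords.
by nia.
Qed.

Lemma parity_free_coords V a b c :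
  det a b c * det a b c = 1 -> parity_free V ->
  parity_free [seq coords a b c v | v <- V].
Proof.
move=> D [odd par].
have frame_add x y : frame a b c (add x y) = add (frame a b c x) (frame a b c y).
  by clear; move: a b c x y; ptring.
split=> [_ m /mapP[v vV ->] E|_ _ m /mapP[v vV ->] /mapP[w wV ->] E].
  by apply: (odd v (frame a b c m) vV); rewrite -frame_add -E frame_coords.
have [|->|->] := par v w (frame a b c m) vV wV; [|by left|right].
  by rewrite -frame_add -E -coords_add frame_coords.
by clear; move: a b c v; ptring.
Qed.

Lemma level_coords a b c v :
  level (coords a b c v) = - dot v (facet_vec a b c).
Proof. move: a b c v; rewrite /level; ptring. Qed.

Lemma matched_isomorphic V a b c U :
  uniq V -> det a b c * det a b c = 1 ->
  perm_eq U [seq coords a b c v | v <- V] -> matched rep_table U ->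
  exists2 L, L \in representatives & isomorphic_pts V L.
Proof.
move=> uV D pU /hasP[_ /mapP[L LR ->] /= /and3P[_ /eqP sz]].
move=> /hasP[a' _ /hasP[b' _ /hasP[c' _ /andP[/eqP D' /allP LU]]]].
exists L => //; exists a, b, c, a', b', c'; split=> // x.
have uL : uniq [seq coords a' b' c' v | v <- L].
  by rewrite (map_inj_uniq (coords_inj D')); apply: (allP uniq_representatives).
have sub : {subset [seq coords a' b' c' v | v <- L] <=
                   [seq coords a b c v | v <- V]}.
  by move=> _ /mapP[v vL ->]; rewrite -(perm_mem pU); apply: LU.
have [|_ ->] // := uniq_min_size uL sub.
by rewrite [leqRHS]size_map sz (perm_size pU).
Qed.

Lemma add_v0 v : add v (0, 0, 0) = v.
Proof. move: v; ptring. Qed.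

(** The link between the vertices of a polytope and the search: in coordinates
    adapted to a facet, the vertices outside the facet form a compatible
    subset of the candidates of total level at most the size of the facet. *)
Section Framed.
Variables (V : seq pt) (a b c : pt) (base edges : seq pt)
          (sorted : seq pt -> bool).
Let W := [seq coords a b c v | v <- V].

Lemma framed_isomorphic :
  uniq V -> unimodular_hull V -> parity_free V -> facet_triple V a b c ->
  full_search (candidates base edges) base rep_table sorted ->
  (forall s t, perm_eq s t -> sorted s = sorted t) -> sorted W ->
  uniq base -> {subset base <= W} ->
  level (vsum base) = - Z.of_nat (size base) ->
  (forall v, v \in V -> dot v (facet_vec a b c) = 1 ->
     coords a b c v \in base) ->
  (forall x, x \in W -> all (fun f => - level x - 1 <=? dot x f) edges) ->
  (forall x, 0 <= level x <= Z.of_nat (size base) ->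
     all (fun f => - level x - 1 <=? dot x f) edges -> x \in cube) ->
  0 <= dot (vsum V) (facet_vec a b c) ->
  exists2 L, L \in representatives & isomorphic_pts V L.
Proof.
move=> uV hV pV abc run sortP sortW ub subW lev_base on_facet edgesW in_cube.
move=> s0; move: run.
have D := facet_det hV abc.
have uW : uniq W by rewrite (map_inj_uniq (coords_inj D)).
pose W' := [seq x <- W | x \notin base].
have uW' : uniq W' by rewrite filter_uniq.
have pW : perm_eq W (base ++ W').
  rewrite -(perm_filterC (mem base) W) perm_cat2r; apply: uniq_perm => //.
    by rewrite filter_uniq.
  move=> x; rewrite mem_filter /=; have [/subW ->|] := boolP (x \in base) => //.
have lev0 x : x \in W' -> 0 <= level x.
  rewrite mem_filter => /andP[xb /mapP[v vV xE]].
  have h := facet_le1 hV abc vV.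
  have h1 : dot v (facet_vec a b c) <> 1.
    by move/(on_facet v vV); rewrite -xE (negPf xb).
  by move: h h1; rewrite xE level_coords; clear; lia.
have levW' : level (vsum W') <= Z.of_nat (size base).
  have := perm_vsum pW; rewrite vsum_coords vsum_cat => /(congr1 level).
  by rewrite level_add level_coords lev_base; lia.
have [oddW parW] := parity_free_coords D pV.
have compatW : {in W &, forall x y, x != y -> compat x y}.
  move=> x y xW yW /eqP xy; apply/implyP => /congr2P[m E].
  by have [/xy|->] := parW x y m xW yW E.
pose C := candidates base edges; pose X := [seq x <- C | x \in W'].
have sub : {subset W' <= C}.
  move=> x xW'; move: (xW'); rewrite mem_filter => /andP[xb xW].
  have l0 := lev0 x xW'.
  have l1 := Z.le_trans _ _ _ (level_le_vsum lev0 xW') levW'.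
  rewrite mem_candidates; apply/and5P; split;
    [exact/Z.leb_le|exact/Z.leb_le|exact: edgesW| |].
    apply/congr2P => -[m E]; apply: (oddW x m xW); rewrite -E.
    by rewrite add_v0.
  apply/andP; split; last by apply: in_cube => //; exact: edgesW.
  apply/allP => y yb; apply: compatW => //; first exact: subW.
  by apply: contraNneq xb => ->.
have pX : perm_eq X W'.
  apply: uniq_perm; rewrite ?filter_uniq ?uniq_candidates // => x.
  by rewrite mem_filter; have [/sub|] := boolP (x \in W').
have pU : perm_eq (catrev X base) W.
  by rewrite catrevE (permPr pW) perm_catC perm_cat2l perm_rev.
have levC x : x \in C -> 0 <= level x.
  by rewrite mem_candidates => /andP[/Z.leb_le].
rewrite /full_search -/C => run.
have : leaf rep_table sorted (catrev X base).
  apply: (search_sound run levC); first exact: filter_subseq.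
    apply: pairwise_uniq_in; first by rewrite filter_uniq ?uniq_candidates.
    move=> x y; rewrite !(perm_mem pX) !mem_filter => /andP[_ xW] /andP[_ yW].
    exact: compatW.
  by rewrite (perm_vsum pX).
rewrite /leaf (sortP _ _ pU) sortW implyTb.
have hU : unimodular_hull (catrev X base).
  apply: (eq_mem_unimodular_hull (V := W)); last exact: unimodular_hull_coords.
  by move=> x; rewrite (perm_mem pU).
move/unimodular_hullP: hU => ->; rewrite implyTb.
exact: (matched_isomorphic uV D pU).
Qed.

End Framed.

Lemma dot_e1 x y z : dot (x, y, z) e1 = x.
Proof. rewrite /=; ring. Qed.

Lemma dot_e2 x y z : dot (x, y, z) e2 = y.
Proof. rewrite /=; ring. Qed.

Lemma dot_e3 x y z : dot (x, y, z) e3 = z.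
Proof. rewrite /=; ring. Qed.

Lemma sorted3_perm s t : perm_eq s t -> sorted3 s = sorted3 t.
Proof. by rewrite /sorted3 => /perm_vsum ->. Qed.

Lemma sorted4_perm s t : perm_eq s t -> sorted4 s = sorted4 t.
Proof. by rewrite /sorted4 => /perm_vsum ->. Qed.

Lemma mem_interval6 x : -6 <= x <= 6 -> x \in interval6.
Proof.
move=> hx; have : [|| x =? -6, x =? -5, x =? -4, x =? -3, x =? -2, x =? -1,
  x =? 0, x =? 1, x =? 2, x =? 3, x =? 4, x =? 5 | x =? 6] by lia.
by rewrite !inE.
Qed.

Lemma mem_cube x y z :
  -6 <= x <= 6 -> -6 <= y <= 6 -> -6 <= z <= 6 -> (x, y, z) \in cube.
Proof.
move=> hx hy hz; apply: allpairs_f; last exact: mem_interval6.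
by apply: allpairs_f; apply: mem_interval6.
Qed.

Lemma edges3_cube x : 0 <= level x <= 3 ->
  all (fun f => - level x - 1 <=? dot x f) edges3 -> x \in cube.
Proof.
case: x => [[x y] z] /= h /and4P[/Z.leb_le h1 /Z.leb_le h2 /Z.leb_le h3 _].
by apply: mem_cube; lia.
Qed.

Lemma edges4_cube x : 0 <= level x <= 4 ->
  all (fun f => - level x - 1 <=? dot x f) edges4 -> x \in cube.
Proof.
case: x => [[x y] z] /= h /and5P[].
move=> /Z.leb_le h1 /Z.leb_le h2 /Z.leb_le h3 /Z.leb_le h4 _.
by apply: mem_cube; lia.
Qed.

Lemma coords_fst a b c : det a b c * det a b c = 1 -> coords a b c a = e1.
Proof.
by move=> D; rewrite /coords dot_dual_fst dot_dual_last dot_dual_cyc D.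
Qed.

Lemma coords_snd a b c : det a b c * det a b c = 1 -> coords a b c b = e2.
Proof.
move=> D; rewrite /coords dot_dual_fst dot_dual_last dot_dual_cyc.
by rewrite (det_cyc a b c) D.
Qed.

Lemma coords_trd a b c : det a b c * det a b c = 1 -> coords a b c c = e3.
Proof.
move=> D; rewrite /coords dot_dual_fst dot_dual_last dot_dual_cyc.
by rewrite (det_cyc b c a) (det_cyc a b c) D.
Qed.

Lemma coords_opp a b c : det a b c * det a b c = 1 ->
  coords a b c (add (add a b) (opp c)) = (1, 1, -1).
Proof.
move=> D; rewrite !coords_add coords_fst // coords_snd //.
have -> : coords a b c (opp c) = opp (coords a b c c).
  by clear; move: a b c; ptring.
by rewrite coords_trd.
Qed.

Section Cases.
Variable V : seq pt.
Hypotheses (V_uniq : uniq V) (V_unimodular : unimodular_hull V)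
           (V_parity : parity_free V).

(** The ray from the origin through the sum of [V], if that sum is nonzero,
    leaves the polytope through this facet. *)
Definition special (a b c : pt) : Prop :=
  forall x y z, facet_triple V x y z ->
    dot (vsum V) (facet_vec x y z) <= dot (vsum V) (facet_vec a b c).

Lemma special_cyc a b c : special a b c -> special b c a.
Proof. by rewrite /special (facet_vec_cyc a b c). Qed.

Lemma special_swap a b c : special a b c -> special b a c.
Proof. by rewrite /special (facet_vec_swap a b c). Qed.

Lemma triangle_lower_bound a b c v :
  triangle V a b c -> v \in V ->
  dot v (facet_vec a b c) - 1 <= dot v (dual_vec a b c).
Proof.
move=> tri; apply: (coord_lower_bound V_unimodular tri.1).
exact: triangle_edge.
Qed.

Lemma parallelogram_lower_bound a b c v :
  parallelogram V a b c -> v \in V ->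
  dot v (facet_vec a b c) - 1 <= dot v (dual_vec a b c).
Proof.
move=> par; have [abc _ _] := par; apply: (coord_lower_bound _ abc) => //.
exact: parallelogram_edge.
Qed.

Lemma triangle_special_ge0 a b c :
  triangle V a b c -> special a b c -> 0 <= dot (vsum V) (dual_vec a b c).
Proof.
move=> tri; apply: (coord_ge0_special V_unimodular tri.1).
exact: triangle_edge.
Qed.

Lemma parallelogram_special_ge0 a b c :
  parallelogram V a b c -> special a b c ->
  0 <= dot (vsum V) (dual_vec a b c).
Proof.
move=> par; have [abc _ _] := par; apply: (coord_ge0_special _ abc) => //.
exact: parallelogram_edge.
Qed.

Let s := vsum V.

Lemma sorted_triangle_isomorphic a b c :
  triangle V a b c -> special a b c ->
  dot s (dual_vec b c a) <= dot s (dual_vec a b c) ->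
  dot s (dual_vec c a b) <= dot s (dual_vec b c a) ->
  exists2 L, L \in representatives & isomorphic_pts V L.
Proof.
move=> t1 sp s12 s23; have t2 := triangle_cyc t1; have t3 := triangle_cyc t2.
have sp2 := special_cyc sp; have sp3 := special_cyc sp2.
have s3 := triangle_special_ge0 t3 sp3.
have [abc on] := t1; have D := facet_det V_unimodular abc.
have [_ aV bV cV _] := facet_tripleP _ _ _ _ abc.
apply: (framed_isomorphic V_uniq V_unimodular V_parity abc
          full_search_triangle sorted3_perm).
- rewrite /sorted3 vsum_coords /coords -/s.
  by apply/and3P; split; apply/Z.leb_le.
- by [].
- move=> x; rewrite !inE => /or3P[] /eqP ->.
  + by rewrite -(coords_fst D) map_f.
  + by rewrite -(coords_snd D) map_f.
  + by rewrite -(coords_trd D) map_f.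
- by [].
- move=> v vV /(on v vV); rewrite !inE => /or3P[] /eqP ->.
  + by rewrite coords_fst.
  + by rewrite coords_snd.
  + by rewrite coords_trd.
- move=> _ /mapP[v vV ->]; have b1 := triangle_lower_bound t1 vV.
  have := triangle_lower_bound t2 vV; have := triangle_lower_bound t3 vV.
  rewrite (facet_vec_cyc b c a) (facet_vec_cyc a b c) => b3 b2.
  rewrite level_coords Z.opp_involutive.
  rewrite /edges3 /coords /all dot_e1 dot_e2 dot_e3 andbT.
  by apply/and3P; split; apply/Z.leb_le.
- exact: edges3_cube.
rewrite dot_facet_coords /coords /= -/s.
by move: s3 s12 s23; rewrite -/s; clear; lia.
Qed.

Lemma triangle_isomorphic a b c :
  triangle V a b c -> special a b c ->
  exists2 L, L \in representatives & isomorphic_pts V L.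
Proof.
move=> t1 sp1; have t2 := triangle_cyc t1; have t3 := triangle_cyc t2.
have sp2 := special_cyc sp1; have sp3 := special_cyc sp2.
have u1 := triangle_swap t1; have u2 := triangle_swap t2.
have u3 := triangle_swap t3; have sq1 := special_swap sp1.
have sq2 := special_swap sp2; have sq3 := special_swap sp3.
pose E := (dual_vecC b c a, dual_vecC c a b, dual_vecC a b c).
have [h12|h12] := Z.le_ge_cases (dot s (dual_vec a b c)) (dot s (dual_vec b c a));
have [h23|h23] := Z.le_ge_cases (dot s (dual_vec b c a)) (dot s (dual_vec c a b));
have [h31|h31] := Z.le_ge_cases (dot s (dual_vec c a b)) (dot s (dual_vec a b c)).
- by apply: (sorted_triangle_isomorphic t1 sp1);
    [exact: Z.le_trans h23 h31|exact: Z.le_trans h31 h12].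
- by apply: (sorted_triangle_isomorphic u2 sq2); rewrite !E.
- by apply: (sorted_triangle_isomorphic u1 sq1); rewrite !E.
- by apply: (sorted_triangle_isomorphic t2 sp2).
- by apply: (sorted_triangle_isomorphic u3 sq3); rewrite !E.
- by apply: (sorted_triangle_isomorphic t3 sp3).
- by apply: (sorted_triangle_isomorphic t1 sp1).
- by apply: (sorted_triangle_isomorphic t1 sp1).
Qed.

Lemma special_opp a b c : special a b c -> special a b (add (add a b) (opp c)).
Proof. by rewrite /special facet_vec_opp. Qed.

Lemma special_turn a b c : special a b c -> special c (add (add a b) (opp c)) a.
Proof. by rewrite /special facet_vec_opp2. Qed.

Lemma dot_dual_turn a b c v :
  [/\ dot v (dual_vec c (add (add a b) (opp c)) a) =
         dot v (dual_vec b c a) + dot v (dual_vec c a b),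
      dot v (dual_vec (add (add a b) (opp c)) a c) = dot v (dual_vec b c a) &
      dot v (dual_vec a c (add (add a b) (opp c))) =
         dot v (dual_vec a b c) - dot v (dual_vec b c a)].
Proof. by split; move: a b c v; ptring. Qed.

Lemma dual_vec_opp_snd a b c :
  dual_vec b (add (add a b) (opp c)) a =
  add (dual_vec b c a) (dual_vec c a b).
Proof. move: a b c; ptring. Qed.

Lemma dual_vec_opp_trd a b c :
  dual_vec (add (add a b) (opp c)) a b = opp (dual_vec c a b).
Proof. move: a b c; ptring. Qed.

Lemma sorted_parallelogram_isomorphic a b c :
  parallelogram V a b c -> special a b c ->
  0 <= dot s (dual_vec c a b) ->
  dot s (dual_vec b c a) + dot s (dual_vec c a b) <= dot s (dual_vec a b c) ->
  exists2 L, L \in representatives & isomorphic_pts V L.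
Proof.
move=> p1 sp s3 s123; have p2 := parallelogram_swap p1.
have p3 := parallelogram_opp p1; have p4 := parallelogram_swap p3.
have s2 := parallelogram_special_ge0 p2 (special_swap sp).
rewrite dual_vecC in s2.
have [abc dV on] := p1; have D := facet_det V_unimodular abc.
have [_ aV bV cV _] := facet_tripleP _ _ _ _ abc.
apply: (framed_isomorphic V_uniq V_unimodular V_parity abc
          full_search_parallelogram sorted4_perm).
- rewrite /sorted4 vsum_coords /coords -/s.
  by apply/and3P; split; apply/Z.leb_le.
- by [].
- move=> x; rewrite !inE => /or4P[] /eqP ->.
  + by rewrite -(coords_fst D) map_f.
  + by rewrite -(coords_snd D) map_f.
  + by rewrite -(coords_trd D) map_f.
  + by rewrite -(coords_opp D) map_f.
- by [].
- move=> v vV /(on v vV); rewrite !inE => /or4P[] /eqP ->.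
  + by rewrite coords_fst.
  + by rewrite coords_snd.
  + by rewrite coords_trd.
  + by rewrite coords_opp.
- move=> _ /mapP[v vV ->]; have b1 := parallelogram_lower_bound p1 vV.
  have := parallelogram_lower_bound p4 vV.
  have := parallelogram_lower_bound p3 vV.
  have := parallelogram_lower_bound p2 vV.
  rewrite !(facet_vec_swap a b) !facet_vec_opp !(dual_vecC b _ a) dual_vec_opp.
  rewrite dual_vec_opp_snd (dot_add v (dual_vec a b c)).
  rewrite (dot_add v (dual_vec b c a)) => b2 b3 b4.
  rewrite level_coords Z.opp_involutive.
  rewrite /edges4 /coords /all dot_e1 dot_e2 andbT /=.
  apply/and4P; split; apply/Z.leb_le => //.
  + by move: b3; clear; lia.
  + by move: b4; clear; lia.
- exact: edges4_cube.
rewrite dot_facet_coords /coords /= -/s.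
by move: s3 s2 s123; rewrite -/s; clear; lia.
Qed.

Lemma parallelogram_isomorphic a b c :
  parallelogram V a b c -> special a b c ->
  exists2 L, L \in representatives & isomorphic_pts V L.
Proof.
(* The symmetries of the parallelogram used in turn are the exchange of [c] with
   the opposite vertex, the exchange of [a] and [b], and the one that maps the
   diagonal [a b] to the other diagonal. *)
wlog s3 : a b c / 0 <= dot s (dual_vec c a b).
  move=> IH par sp.
  have [|s3] := Z.le_ge_cases 0 (dot s (dual_vec c a b)); first by move/IH; apply.
  apply: (IH a b (add (add a b) (opp c))) (parallelogram_opp par) (special_opp sp).
  by rewrite dual_vec_opp_trd /opp dot_scale; move: s3; clear; lia.
wlog s12 : a b c s3 / dot s (dual_vec b c a) <= dot s (dual_vec a b c).
  move=> IH par sp.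
  have [|s12] := Z.le_ge_cases (dot s (dual_vec b c a)) (dot s (dual_vec a b c)).
    by move/(IH a b c s3); apply.
  apply: (IH b a c) (parallelogram_swap par) (special_swap sp).
    by rewrite dual_vecC.
  by rewrite (dual_vecC a b c) (dual_vecC b c a).
move=> par sp.
have [|s123] := Z.le_ge_cases
  (dot s (dual_vec b c a) + dot s (dual_vec c a b)) (dot s (dual_vec a b c)).
  exact: sorted_parallelogram_isomorphic par sp s3.
have [E1 E2 E3] := dot_dual_turn a b c s.
apply: (sorted_parallelogram_isomorphic (parallelogram_turn par)
          (special_turn sp)); rewrite ?E1 ?E2 ?E3.
- by move: s12; clear; lia.
- by move: s123; clear; lia.
Qed.

Lemma special_exists x y z :
  facet_triple V x y z ->
  exists a b c, facet_triple V a b c /\ special a b c.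
Proof.
move=> xyz; pose f (t : pt * pt * pt) := dot s (facet_vec t.1.1 t.1.2 t.2).
have [|||[[a b] c]] := @seq_argmin _ (fun t t' => f t' <=? f t) (facet_triples V).
- by move: xyz; rewrite -mem_facet_triples; apply: contraTneq => ->.
- by move=> t u _ _; clear; lia.
- by move=> t u v _ _ _; clear; lia.
rewrite mem_facet_triples => abc abcmax; exists a, b, c; split=> // u v w.
by rewrite -mem_facet_triples => /abcmax /Z.leb_le.
Qed.

End Cases.

Theorem unimodular_hull_classification V x y z :
  uniq V -> unimodular_hull V -> parity_free V -> facet_triple V x y z ->
  exists2 L, L \in representatives & isomorphic_pts V L.
Proof.
move=> uV hV pV /special_exists[a [b [c [abc sp]]]].
have [tri|par|par|par] := facet_shape hV abc.
- exact: (triangle_isomorphic uV hV pV tri).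
- exact: (parallelogram_isomorphic uV hV pV par).
- exact: (parallelogram_isomorphic uV hV pV par (special_cyc sp)).
- exact: (parallelogram_isomorphic uV hV pV par (special_cyc (special_cyc sp))).
Qed.

Local Close Scope Z_scope.

From mathcomp Require Import ring lra.

(** * Convex hulls of finite sets *)

Import Order.TTheory GRing.Theory Num.Theory.
Import numFieldNormedType.Exports.
Local Open Scope classical_set_scope.
Local Open Scope ring_scope.

Section Pairing.
Context {R : realType} {n : nat}.
Implicit Types x y z : 'rV[R]_n.

Lemma pairingC x y : pairing x y = pairing y x.
Proof. by apply: eq_bigr => i _; rewrite mulrC. Qed.

Lemma pairingDl x y z : pairing (x + y) z = pairing x z + pairing y z.
Proof. by rewrite -big_split; apply: eq_bigr => i _; rewrite mxE mulrDl. Qed.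

Lemma pairingZl k x z : pairing (k *: x) z = k * pairing x z.
Proof. by rewrite mulr_sumr; apply: eq_bigr => i _; rewrite mxE mulrA. Qed.

Lemma pairingDr x y z : pairing z (x + y) = pairing z x + pairing z y.
Proof. by rewrite !(pairingC z) pairingDl. Qed.

Lemma pairingZr k x z : pairing z (k *: x) = k * pairing z x.
Proof. by rewrite !(pairingC z) pairingZl. Qed.

Lemma pairingNl x z : pairing (- x) z = - pairing x z.
Proof. by rewrite -scaleN1r pairingZl mulN1r. Qed.

Lemma pairingNr x z : pairing z (- x) = - pairing z x.
Proof. by rewrite !(pairingC z) pairingNl. Qed.

Lemma pairing0l z : pairing 0 z = 0.
Proof. by rewrite -(scale0r 0) pairingZl mul0r. Qed.

Lemma pairing0r z : pairing z 0 = 0.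
Proof. by rewrite pairingC pairing0l. Qed.

Lemma pairing_gt0 x : x != 0 -> 0 < pairing x x.
Proof.
move=> x0; have sq i : true -> 0 <= x 0 i * x 0 i by rewrite -expr2 sqr_ge0.
rewrite lt_neqAle sumr_ge0 // andbT eq_sym psumr_eq0 //.
apply: contraNN x0 => /allP h; apply/eqP/matrixP => i j; rewrite ord1 mxE.
by apply/eqP; rewrite -sqrf_eq0 expr2; apply: h; rewrite mem_index_enum.
Qed.

Lemma pairing_eq0 x : (forall y, pairing x y = 0) -> x = 0.
Proof.
move=> h; apply/eqP; apply/negPn/negP => /pairing_gt0.
by rewrite h ltxx.
Qed.

End Pairing.

Section Farkas.
Context {R : realType} {W : lmodType R}.
Implicit Types (f b : W -> R) (s : seq (W -> R)).

Definition linear_form f : Prop := forall k x y, f (k *: x + y) = k * f x + f y.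

Fixpoint all_ge0 s (x : W) : Prop :=
  if s is f :: s' then 0 <= f x /\ all_ge0 s' x else True.

Fixpoint all_linear s : Prop :=
  if s is f :: s' then linear_form f /\ all_linear s' else True.

Fixpoint form_cone s b : Prop :=
  if s is f :: s' then
    exists2 k, 0 <= k & form_cone s' (fun x => b x - k * f x)
  else forall x, b x = 0.

Lemma eq_form_cone s b b' : b =1 b' -> form_cone s b -> form_cone s b'.
Proof. by move=> /funext ->. Qed.

(** The composition of [b] with the projection along [x0] onto the kernel of
    [f]. *)
Definition project f (x0 : W) b : W -> R := fun x => b x - b x0 / f x0 * f x.

(** Undoing the projection adds a multiple of [f] that is nonnegative because
    [f] is negative at [x0] whereas the forms of [s] are not. *)
Lemma form_cone_project f x0 s b :
  f x0 < 0 -> all_ge0 s x0 -> form_cone (map (project f x0) s) b ->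
  exists2 k, 0 <= k & form_cone s (fun x => b x - k * f x).
Proof.
move=> fx0; elim: s b => [|g s IH] b /= => [_ b0|[gx0 sx0] [k k0 /IH[]// m m0 h]].
  by exists 0 => // x; rewrite b0 mul0r subr0.
have q0 : g x0 / f x0 <= 0 by rewrite mulr_ge0_le0 // invr_le0 ltW.
exists (m - k * (g x0 / f x0)).
  by rewrite subr_ge0 (le_trans _ m0) // mulr_ge0_le0.
exists k => //; apply: eq_form_cone h => x.
by rewrite /project; ring.
Qed.

Lemma linear_project f x0 b :
  linear_form f -> linear_form b -> linear_form (project f x0 b).
Proof. by move=> lf lb k x y; rewrite /project lf lb; ring. Qed.

(** Farkas' lemma, by induction on the number of forms: if [b] is not implied by
    the forms other than [f], as witnessed by [x0], then projecting all forms
    along [x0] onto the kernel of [f] reduces the claim to fewer forms. *)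
Lemma farkas s b :
  all_linear s -> linear_form b ->
  (forall x, all_ge0 s x -> 0 <= b x) -> form_cone s b.
Proof.
have [m] := ubnP (size s); elim: m s b => // m IH [|f s] b /= sm.
  move=> _ lb b0 x; apply/eqP; rewrite eq_le b0 // andbT.
  have bz : b 0 = 0 by have := lb (-1) 0 0; rewrite scaler0 addr0; lra.
  by have := b0 (-1 *: x + 0) I; rewrite lb bz; lra.
move=> [lf ls] lb h.
have [h'|] := pselect (forall x, all_ge0 s x -> 0 <= b x).
  exists 0 => //; have := IH s b sm ls lb h'.
  by apply: eq_form_cone => x; rewrite mul0r subr0.
move=> /existsNP[x0 /not_implyP[sx0 /negP]]; rewrite -ltNge => bx0.
have fx0 : f x0 < 0.
  rewrite ltNge; apply/negP => f0.
  by have := h x0 (conj f0 sx0); rewrite leNgt bx0.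
have [|k k0 hk] := @form_cone_project f x0 s (project f x0 b) fx0 sx0.
  apply: IH; rewrite ?size_map //.
  - elim: s ls {sm sx0 h} => //= g s IHs [lg ls].
    by split; [exact: linear_project|exact: IHs].
  - exact: linear_project.
  - move=> x hx; pose x' := - (f x / f x0) *: x0 + x.
    have E g : linear_form g -> g x' = project f x0 g x.
      by move=> lg; rewrite lg /project; ring.
    rewrite -E //; apply: h; split.
      by rewrite E // /project divff ?lt_eqF // mul1r subrr.
    elim: s ls {sm sx0} hx => //= g s IHs [lg ls] [gx sx].
    by split; [rewrite E|exact: IHs].
exists (k + b x0 / f x0).
  by rewrite addr_ge0 // ltW // nmulr_rgt0 // invr_lt0.
apply: eq_form_cone hk => x.
by rewrite /project; ring.
Qed.

End Farkas.

Section Hulls.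
Context {R : realType} {n : nat}.
Implicit Types (A C : set 'rV[R]_n) (s V : seq 'rV[R]_n) (x y : 'rV[R]_n).

Local Notation hull := Defs.conv.

Definition convex_comb_closed C : Prop :=
  forall x y (k : R), C x -> C y -> 0 <= k -> k <= 1 ->
    C (k *: x + (1 - k) *: y).

Lemma convex_setP C : convex_set C <-> convex_comb_closed C.
Proof.
split=> [cC x y k Cx Cy k0 k1|cC x y k /set_mem Cx /set_mem Cy].
  by apply: set_mem (cC x y (Itv01 k0 k1) _ _); exact/mem_set.
by apply/mem_set/cC => //; rewrite ?ge0 ?le1.
Qed.

Lemma hull_closed A : convex_comb_closed (hull A).
Proof.
move=> x y k Ax Ay k0 k1 C [/convex_setP cC AC].
have hC : convex_set C /\ A `<=` C by split=> //; exact/convex_setP.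
by apply: cC => //; [exact: Ax hC|exact: Ay hC].
Qed.

Lemma sub_hull A : A `<=` hull A.
Proof. exact: sub_gen_smallest. Qed.

Lemma hull_sub A C : convex_comb_closed C -> A `<=` C -> hull A `<=` C.
Proof. by move=> cC; apply: smallest_sub; apply/convex_setP. Qed.

Lemma hull_le A C : A `<=` hull C -> hull A `<=` hull C.
Proof. by apply: hull_sub; exact: hull_closed. Qed.

Lemma halfspace_closed y c : convex_comb_closed [set x | c <= pairing x y].
Proof.
move=> x z k /= hx hz k0 k1; rewrite pairingDl !pairingZl.
have -> : c = k * c + (1 - k) * c by ring.
by rewrite lerD // ler_wpM2l // subr_ge0.
Qed.

Lemma hull_ge A y c :
  (forall v, A v -> c <= pairing v y) -> forall x, hull A x -> c <= pairing x y.
Proof. by move=> h; apply: (hull_sub (@halfspace_closed y c)). Qed.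

Lemma hull_le_form A y c :
  (forall v, A v -> pairing v y <= c) -> forall x, hull A x -> pairing x y <= c.
Proof.
move=> h x Ax; rewrite -lerN2 -pairingNr; apply: hull_ge Ax => v /h.
by rewrite pairingNr lerN2.
Qed.

(** The combinations of [s] with nonnegative coefficients of sum [w]. Splitting
    off one generator at a time matches [form_cone]. *)
Fixpoint weighted s (w : R) x : Prop :=
  if s is v :: s' then exists2 k, 0 <= k & weighted s' (w - k) (x - k *: v)
  else w = 0 /\ x = 0.

Lemma weighted_ge0 s w x : weighted s w x -> 0 <= w.
Proof.
elim: s w x => /= [w x [-> _]|v s IH w x [k k0 /IH]] //.
by rewrite subr_ge0; exact: le_trans.
Qed.

Lemma weighted0 s x : weighted s 0 x -> x = 0.
Proof.
elim: s x => /= [x []|v s IH x [k k0]] //; rewrite sub0r => h.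
have kE : k = 0.
  by apply/eqP; rewrite eq_le k0 andbT -oppr_ge0; exact: weighted_ge0 h.
by move: h; rewrite kE oppr0 scale0r subr0 => /IH.
Qed.

Lemma weighted_hull C s w x :
  convex_comb_closed C -> (forall v, v \in s -> C v) -> 0 < w ->
  weighted s w x -> C (w^-1 *: x).
Proof.
move=> cC; elim: s w x => /= [w x _ w0 [wE]|v s IH w x sC w0 [k k0 h]].
  by rewrite wE ltxx in w0.
have := weighted_ge0 h; rewrite le_eqVlt => /predU1P[/esym wk|wk].
  move: h; rewrite wk => /weighted0/eqP; rewrite subr_eq0 => /eqP ->.
  have kw : k = w by apply/eqP; rewrite eq_sym -subr_eq0 wk.
  by rewrite kw scalerA mulVf ?gt_eqF // scale1r; apply: sC; rewrite mem_head.
have Cz : C ((w - k)^-1 *: (x - k *: v)).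
  by apply: IH h => // u us; apply: sC; rewrite inE us orbT.
have -> : w^-1 *: x = (k / w) *: v + (1 - k / w) *: ((w - k)^-1 *: (x - k *: v)).
  have -> : 1 - k / w = (w - k) / w by rewrite mulrBl divff // gt_eqF.
  rewrite scalerA mulrAC divff ?gt_eqF // mul1r scalerBr scalerA.
  by rewrite [w^-1 * k]mulrC addrC subrK.
apply: cC => //; first by apply: sC; rewrite mem_head.
  by rewrite divr_ge0 // ltW.
by rewrite ler_pdivrMr // mul1r -subr_ge0 ltW.
Qed.

(** A point outside a polytope is strictly separated from it: otherwise Farkas'
    lemma, applied to affine forms, makes it a convex combination of the
    generators. *)
Lemma separation s x :
  ~ hull [set` s] x ->
  exists y c, (forall v, v \in s -> c <= pairing v y) /\ pairing x y < c.
Proof.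
move=> nx; apply: contrapT => nsep; apply: nx.
pose form (w : R) (v : 'rV[R]_n) := fun p : 'rV[R]_n * R^o =>
  pairing v p.1 + w * p.2.
have lin w v : linear_form (form w v).
  by move=> k p q; rewrite /form pairingDr pairingZr /= -[k *: p.2]/(k * p.2); ring.
have cone : form_cone [seq form 1 v | v <- s] (form 1 x).
  apply: farkas => //; first by elim: s {nsep} => //= v s IH; split.
  move=> [y c] hs; rewrite leNgt; apply/negP => hx; apply: nsep.
  exists y, (- c); split; last by move: hx; rewrite /form /= mul1r; lra.
  move=> v; elim: s hs => //= u s IH [hu hs].
  rewrite inE => /predU1P[->|/IH]; last exact.
  by move: hu; rewrite /form /= mul1r; lra.
have form_weighted w z : form_cone [seq form 1 v | v <- s] (form w z) ->
    weighted s w z.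
  elim: s w z {nsep cone} => /= [w z h|v s IH w z [k k0 h]].
    split; first by have := h (0, 1); rewrite /form /= pairing0r; lra.
    by apply: pairing_eq0 => y; have := h (y, 0); rewrite /form /=; lra.
  exists k => //; apply: IH; apply: eq_form_cone h => p.
  by rewrite /form pairingDl pairingNl pairingZl; ring.
have := form_weighted 1 x cone.
move/(@weighted_hull (hull [set` s]) _ _ _ (@hull_closed _)).
by rewrite invr1 scale1r; apply=> // v vs; exact: sub_hull.
Qed.

Lemma face_trans A F x : is_face A [set x] -> F `<=` A -> F x -> is_face F [set x].
Proof.
move=> [u [c [h E]]] FA Fx; exists u, c; split; first by move=> z /FA/h.
apply/seteqP; split=> z /=.
  by move=> ->; split=> //; have : [set x] x by []; rewrite E => -[].
by move=> [/FA Az zc]; have : (A `&` [set x | pairing x u = c]) z by []; rewrite -E.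
Qed.

Lemma seq_lower_bound s y c :
  (forall v, v \in s -> c < pairing v y) ->
  exists2 c', c < c' & forall v, v \in s -> c' <= pairing v y.
Proof.
elim: s => [_|v s IH h]; first by exists (c + 1) => //; rewrite ltrDl.
have [|c' cc' hc'] := IH; first by move=> u us; apply: h; rewrite inE us orbT.
exists (Num.min c' (pairing v y)); first by rewrite lt_min cc' h // mem_head.
by move=> u; rewrite inE => /predU1P[->|/hc' uc]; rewrite ge_min ?lexx ?uc ?orbT.
Qed.

Lemma vertex_hull s v : vertices (hull [set` s]) v -> v \in s.
Proof.
move=> [u [c [h E]]]; apply: contrapT => /negP vs.
have [hv vc] : (hull [set` s] `&` [set x | pairing x u = c]) v by rewrite -E.
have [|c' cc' hc'] := @seq_lower_bound s u c.
  move=> w ws; rewrite lt_neqAle h ?andbT; last exact: sub_hull.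
  apply: contraNN vs => /eqP wc.
  suff : [set v] w by move=> <-.
  by rewrite E; split=> //; exact: sub_hull.
have := hull_ge (A := [set` s]) hc' hv.
by rewrite vc leNgt cc'.
Qed.

(** The form that separates [v] from the other generators exposes [v]. *)
Lemma hull_vertex s v :
  v \in s -> ~ hull [set` [seq w <- s | w != v]] v -> vertices (hull [set` s]) v.
Proof.
move=> vs /separation[y [c [hs hv]]].
pose C := [set x | x = v \/ pairing v y < pairing x y].
have cC : convex_comb_closed C.
  move=> x z k Cx Cz k0 k1.
  have [->|kn0] := eqVneq k 0; first by rewrite scale0r add0r subr0 scale1r.
  have [->|kn1] := eqVneq k 1; first by rewrite subrr scale0r addr0 scale1r.
  have kp : 0 < k by rewrite lt_neqAle eq_sym kn0.
  have k'p : 0 < 1 - k by rewrite subr_gt0 lt_neqAle kn1.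
  have wk u : C u -> pairing v y <= pairing u y by move=> [->|/ltW].
  case: Cx => [->|hx].
    case: Cz => [->|hz]; first by left; rewrite -scalerDl addrC subrK scale1r.
    by right; rewrite pairingDl !pairingZl; nra.
  by right; rewrite pairingDl !pairingZl; have := wk z Cz; nra.
have sC : hull [set` s] `<=` C.
  apply: hull_sub => // w /= ws; have [->|wv] := eqVneq w v; [by left|right].
  by apply: lt_le_trans hv (hs _ _); rewrite mem_filter wv.
exists y, (pairing v y); split; first by move=> x /sC[->|/ltW].
apply/seteqP; split=> x /=; first by move=> ->; split=> //; exact: sub_hull.
by move=> [/sC[//|+] xv]; rewrite xv ltxx.
Qed.

(** Generators that lie in the hull of the others can be dropped one after the
    other; by [hull_vertex] those that remain are vertices. *)
Lemma polytope_vertices s :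
  exists V, [/\ uniq V, hull [set` V] = hull [set` s] &
             vertices (hull [set` s]) = [set` V]].
Proof.
have [m] := ubnP (size s); elim: m s => // m IH s sm.
have [[v vs hv]|nv] := pselect (exists2 v, v \in s &
    hull [set` [seq w <- s | w != v]] v).
  have [|V [uV hV vV]] := IH [seq w <- s | w != v].
    rewrite size_filter -ltnS; apply: leq_trans sm; rewrite ltnS.
    by rewrite -(count_predC (pred1 v) s) -subn_gt0 addnK -has_count has_pred1.
  suff E : hull [set` [seq w <- s | w != v]] = hull [set` s].
    by exists V; rewrite -E.
  apply/seteqP; split; apply: hull_le => w /=.
    by rewrite mem_filter => /andP[_ ws]; exact: sub_hull.
  move=> ws; have [->//|wv] := eqVneq w v.
  by apply: sub_hull; rewrite /= mem_filter wv.
have E : [set` undup s] = [set` s] by apply/seteqP; split=> w /=; rewrite mem_undup.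
exists (undup s); rewrite undup_uniq E; split=> //.
apply/seteqP; split=> v /=; first exact: vertex_hull.
by move=> vs; apply: hull_vertex => // h; apply: nv; exists v.
Qed.

Lemma cancel3 (u v w : 'rV[R]_n) : u + v + w - u - v - w = 0.
Proof. by rewrite -(addrA u) (addrC u) addrK (addrC v) addrK subrr. Qed.

Lemma hull3 A a b c (k l m : R) :
  hull A a -> hull A b -> hull A c -> 0 <= k -> 0 <= l -> 0 <= m ->
  k + l + m = 1 -> hull A (k *: a + l *: b + m *: c).
Proof.
move=> ha hb hc k0 l0 m0 E.
have h0 v : v \in [:: a; b; c] -> hull A v.
  by rewrite !inE => /or3P[] /eqP ->.
have := @weighted_hull (hull A) [:: a; b; c] 1 (k *: a + l *: b + m *: c)
  (@hull_closed A) h0 ltr01.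
rewrite invr1 scale1r; apply; exists k => //; exists l => //; exists m => //.
split; first by rewrite -E; ring.
exact: cancel3.
Qed.

End Hulls.

(** * Lattice points in real space *)

Section Embedding.
Context {R : realType}.
Local Notation hull := Defs.conv.

Definition realZ (z : Z) : R := (int_of_Z z)%:~R.

Lemma realZD x y : realZ (x + y)%Z = realZ x + realZ y.
Proof. by rewrite /realZ (raddfD int_of_Z) /= rmorphD. Qed.

Lemma realZM x y : realZ (x * y)%Z = realZ x * realZ y.
Proof. by rewrite /realZ (rmorphM int_of_Z) /= rmorphM. Qed.

Lemma realZN x : realZ (- x)%Z = - realZ x.
Proof. by rewrite /realZ (raddfN int_of_Z) /= rmorphN. Qed.

Lemma realZB x y : realZ (x - y)%Z = realZ x - realZ y.
Proof. by rewrite -realZN -realZD. Qed.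

Lemma realZ0 : realZ 0 = 0. Proof. by []. Qed.
Lemma realZ1 : realZ 1 = 1. Proof. by []. Qed.

Definition realZE := (realZB, realZD, realZM, realZN, realZ0, realZ1).

Lemma realZ_le x y : (realZ x <= realZ y) = (x <=? y)%Z.
Proof. by rewrite ler_int; lia. Qed.

Lemma realZ_lt x y : (realZ x < realZ y) = (x <? y)%Z.
Proof. by rewrite ltr_int; lia. Qed.

Lemma realZ_inj : injective realZ.
Proof. by move=> x y /intr_inj; lia. Qed.

Definition coordinate (v : pt) (i : nat) : Z := nth 0%Z [:: v.1.1; v.1.2; v.2] i.

Definition zrow (v : pt) : 'rV[int]_3 := \row_i int_of_Z (coordinate v i).

Definition zpt (m : 'rV[int]_3) : pt :=
  (Z_of_int (m 0 0), Z_of_int (m 0 1), Z_of_int (m 0 2%:R)).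

Definition vec (v : pt) : 'rV[R]_3 := embZ (zrow v).

Lemma ord3P (P : 'I_3 -> Prop) : P 0 -> P 1 -> P 2%:R -> forall i, P i.
Proof.
move=> P0 P1 P2 [[|[|[|//]]] hi].
- by rewrite (_ : Ordinal hi = 0) //; apply: val_inj.
- by rewrite (_ : Ordinal hi = 1) //; apply: val_inj.
- by rewrite (_ : Ordinal hi = 2%:R) //; apply: val_inj.
Qed.

Lemma zrowK : cancel zrow zpt.
Proof. by move=> [[x y] z]; rewrite /zpt !mxE /= !int_of_ZK. Qed.

Lemma zptK : cancel zpt zrow.
Proof.
move=> m; apply/matrixP => i j; rewrite ord1 !mxE; move: j.
by apply: ord3P; rewrite /= Z_of_intK.
Qed.

Lemma vecE v i : vec v 0 i = realZ (coordinate v i).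
Proof. by rewrite !mxE. Qed.

Lemma vec_lattice v : lattice (vec v).
Proof. by exists (zrow v). Qed.

Lemma latticeP (x : 'rV[R]_3) : lattice x -> exists v, x = vec v.
Proof. by move=> [m _ <-]; exists (zpt m); rewrite /vec zptK. Qed.

Lemma vec_inj : injective vec.
Proof.
move=> x y h; apply: (can_inj zrowK); apply/matrixP => i j.
by have := congr1 (fun m : 'rV[R]_3 => m i j) h; rewrite !mxE => /intr_inj.
Qed.

Lemma pairing3 (x y : 'rV[R]_3) :
  pairing x y = x 0 0 * y 0 0 + x 0 1 * y 0 1 + x 0 2%:R * y 0 2%:R.
Proof.
rewrite /pairing !big_ord_recl big_ord0 addr0 addrA.
by congr (_ + _ * _ + _ * _); congr (_ _ _); apply: val_inj.
Qed.

Lemma pairing_vec u v : pairing (vec u) (vec v) = realZ (dot u v).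
Proof.
rewrite pairing3 !vecE; case: u v => [[u1 u2] u3] [[v1 v2] v3] /=.
by rewrite !realZE.
Qed.

Lemma vecD u v : vec (add u v) = vec u + vec v.
Proof.
apply/matrixP => i j; rewrite ord1 [in RHS]mxE !vecE.
by case: u v => [[? ?] ?] [[? ?] ?]; move: j; apply: ord3P; rewrite /= !realZE.
Qed.

Lemma vecZ k u : vec (scale k u) = realZ k *: vec u.
Proof.
apply/matrixP => i j; rewrite ord1 [in RHS]mxE !vecE.
by case: u => [[? ?] ?]; move: j; apply: ord3P; rewrite /= !realZE.
Qed.

Lemma vecN u : vec (opp u) = - vec u.
Proof. by rewrite /opp vecZ (realZN 1) realZ1 scaleN1r. Qed.

Lemma vec0 : vec (0, 0, 0)%Z = 0.
Proof.
by apply/matrixP => i j; rewrite ord1 [in RHS]mxE vecE; move: j; apply: ord3P.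
Qed.

Lemma frame_coords_real a b c (x : 'rV[R]_3) :
  realZ (det a b c * det a b c) *: x =
  pairing x (vec (dual_vec a b c)) *: vec a +
  pairing x (vec (dual_vec b c a)) *: vec b +
  pairing x (vec (dual_vec c a b)) *: vec c.
Proof.
apply/matrixP => i j; rewrite ord1 !mxE !pairing3 !vecE -!/(realZ _).
case: a b c => [[a1 a2] a3] [[b1 b2] b3] [[c1 c2] c3].
rewrite /dual_vec /det; move: j; apply: ord3P; rewrite /= !realZE; ring.
Qed.

Lemma det_orthogonal a b c (x : 'rV[R]_3) :
  realZ (det a b c) *: x =
  pairing x (vec a) *: vec (cross b c) + pairing x (vec b) *: vec (cross c a) +
  pairing x (vec c) *: vec (cross a b).
Proof.
apply/matrixP => i j; rewrite ord1 !mxE !pairing3 !vecE -!/(realZ _).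
case: a b c => [[a1 a2] a3] [[b1 b2] b3] [[c1 c2] c3].
rewrite /det; move: j; apply: ord3P; rewrite /= !realZE; ring.
Qed.

Lemma orthogonal_eq0 a b c (x : 'rV[R]_3) : det a b c <> 0%Z ->
  pairing x (vec a) = 0 -> pairing x (vec b) = 0 -> pairing x (vec c) = 0 ->
  x = 0.
Proof.
move=> D xa xb xc; have := det_orthogonal a b c x.
rewrite xa xb xc !scale0r !addr0 => /eqP; rewrite scaler_eq0.
by case/orP => /eqP // D0; case: D; apply: realZ_inj.
Qed.

Definition pts (V : seq pt) : set 'rV[R]_3 := [set` [seq vec v | v <- V]].

Lemma ptsP V x : pts V x <-> exists2 v, v \in V & x = vec v.
Proof. by split=> [/mapP|/(mapP (f := vec))]. Qed.

Lemma pts_vec V v : v \in V -> pts V (vec v).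
Proof. by move=> vV; apply/ptsP; exists v. Qed.

Lemma pairing_facet_vec a b c (x : 'rV[R]_3) :
  pairing x (vec (facet_vec a b c)) = pairing x (vec (dual_vec a b c)) +
    pairing x (vec (dual_vec b c a)) + pairing x (vec (dual_vec c a b)).
Proof. by rewrite /facet_vec !vecD !pairingDr. Qed.

(** * Polytopes with unimodular facets *)

Section Fan.
Variables (V : seq pt) (a0 b0 c0 : pt).
Hypotheses (V_unimodular : unimodular_hull V) (triple0 : facet_triple V a0 b0 c0).

Lemma edge_coord_ge0 a b c (x : 'rV[R]_3) :
  facet_triple V a b c ->
  (forall v, v \in V -> dot v (facet_vec a b c) = 1%Z ->
    (0 <= dot v (dual_vec a b c))%Z) ->
  (forall u v w, facet_triple V u v w ->
    pairing x (vec (facet_vec u v w)) <= pairing x (vec (facet_vec a b c))) ->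
  0 <= pairing x (vec (dual_vec a b c)).
Proof.
move=> abc edge xmax.
have [w [t [wbc t0 E]]] := facet_across V_unimodular abc edge.
have := xmax _ _ _ wbc; rewrite E vecD vecZ pairingDr pairingZr realZN.
have : 0 < realZ t by rewrite (realZ_lt 0); lia.
by move: (realZ t) (pairing x _) (pairing x _) => r p q; nra.
Qed.

(** The cones over the facet triples cover the space: a facet plane on which [x]
    is highest contains the ray of [x] on the inner side of all edges, because
    crossing an edge does not raise [x]. For a parallelogram with diagonal [a b]
    the four edges put [x] in the cone over one of the two triangles. *)
Lemma cone_cover (x : 'rV[R]_3) :
  exists a b c, [/\ facet_triple V a b c,
    0 <= pairing x (vec (dual_vec a b c)),
    0 <= pairing x (vec (dual_vec b c a)) &
    0 <= pairing x (vec (dual_vec c a b))].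
Proof.
pose f (t : pt * pt * pt) := pairing x (vec (facet_vec t.1.1 t.1.2 t.2)).
have [|||[[a b] c]] := @seq_argmin _ (fun t t' => f t' <= f t) (facet_triples V).
- by move: triple0; rewrite -mem_facet_triples; apply: contraTneq => ->.
- by move=> t u _ _; rewrite le_total.
- by move=> t u v _ _ _ h1 h2; exact: le_trans h2 h1.
rewrite mem_facet_triples => abc abcmax.
have {abcmax} xmax u v w : facet_triple V u v w ->
    pairing x (vec (facet_vec u v w)) <= pairing x (vec (facet_vec a b c)).
  by rewrite -mem_facet_triples => /abcmax.
have par u v w : parallelogram V u v w -> facet_vec u v w = facet_vec a b c ->
  exists a b c, [/\ facet_triple V a b c,
    0 <= pairing x (vec (dual_vec a b c)),
    0 <= pairing x (vec (dual_vec b c a)) &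
    0 <= pairing x (vec (dual_vec c a b))].
  move=> p1 E; have p2 := parallelogram_swap p1.
  have p3 := parallelogram_opp p1; have p4 := parallelogram_swap p3.
  have ge0 y z t : parallelogram V y z t -> facet_vec y z t = facet_vec a b c ->
      0 <= pairing x (vec (dual_vec y z t)).
    move=> p E'; have [yzt _ _] := p.
    apply: edge_coord_ge0 => //; first exact: parallelogram_edge.
    by rewrite E'.
  have h1 := ge0 _ _ _ p1 E.
  have := ge0 _ _ _ p2; rewrite facet_vec_swap dual_vecC => /(_ E) h2.
  have := ge0 _ _ _ p3; rewrite facet_vec_opp => /(_ E) h3.
  have := ge0 _ _ _ p4.
  rewrite facet_vec_swap facet_vec_opp (dual_vecC v _ u) => /(_ E) h4.
  have [h|h] := leP 0 (pairing x (vec (dual_vec w u v))).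
    by have [? _ _] := p1; exists u, v, w.
  have [? _ _] := p3; exists u, v, (add (add u v) (opp w)); split=> //.
  by rewrite dual_vec_opp_trd vecN pairingNr oppr_ge0 ltW.
have [tri|p|p|p] := facet_shape V_unimodular abc.
- exists a, b, c; have t2 := triangle_cyc tri; have t3 := triangle_cyc t2.
  have [_ _] := (t2, t3); split=> //; apply: edge_coord_ge0.
  + by [].
  + exact: triangle_edge.
  + by [].
  + exact: t2.1.
  + exact: triangle_edge.
  + by rewrite (facet_vec_cyc a b c).
  + exact: t3.1.
  + exact: triangle_edge.
  + by rewrite (facet_vec_cyc b c a) (facet_vec_cyc a b c).
- exact: par p _.
- by apply: par p _; rewrite (facet_vec_cyc a b c).
- by apply: par p _; rewrite (facet_vec_cyc b c a) (facet_vec_cyc a b c).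
Qed.

Lemma cone_coords a b c (x : 'rV[R]_3) : facet_triple V a b c ->
  x = pairing x (vec (dual_vec a b c)) *: vec a +
      pairing x (vec (dual_vec b c a)) *: vec b +
      pairing x (vec (dual_vec c a b)) *: vec c.
Proof.
by move=> /(facet_det V_unimodular) D; rewrite -frame_coords_real D scale1r.
Qed.

Lemma hull_facet_le1 a b c (x : 'rV[R]_3) :
  facet_triple V a b c -> hull (pts V) x ->
  pairing x (vec (facet_vec a b c)) <= 1.
Proof.
move=> abc; apply: hull_le_form => _ /ptsP[v vV ->].
by rewrite pairing_vec (realZ_le _ 1); have := facet_le1 V_unimodular abc vV; lia.
Qed.

Lemma hull0 : hull (pts V) 0.
Proof.
have [a [b [c [abc h1 h2 h3]]]] := cone_cover (- vec a0).
have [_ aV bV cV _] := facet_tripleP _ _ _ _ abc.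
have [_ aV0 _ _ _] := facet_tripleP _ _ _ _ triple0.
have := cone_coords (- vec a0) abc.
move: (pairing _ _) (pairing _ _) (pairing _ _) h1 h2 h3 => m l k k0 l0 m0 E.
have w0 : 0 < 1 + k + l + m by lra.
have : weighted [:: vec a0; vec a; vec b; vec c] (1 + k + l + m) 0.
  exists 1; first exact: ler01; exists k => //; exists l => //; exists m => //.
  split; first by ring.
  by rewrite scale1r add0r E; exact: cancel3.
have h0 v : v \in [:: vec a0; vec a; vec b; vec c] -> hull (pts V) v.
  by rewrite !inE => /or4P[] /eqP ->; apply: sub_hull; apply: pts_vec.
by move/(weighted_hull (@hull_closed _ _ (pts V)) h0 w0); rewrite scaler0.
Qed.

Lemma hullP (x : 'rV[R]_3) :
  hull (pts V) x <->
  forall a b c, facet_triple V a b c -> pairing x (vec (facet_vec a b c)) <= 1.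
Proof.
split=> [hx a b c abc|h]; first exact: hull_facet_le1.
have [a [b [c [abc h1 h2 h3]]]] := cone_cover x.
have [_ aV bV cV _] := facet_tripleP _ _ _ _ abc.
have := h _ _ _ abc; rewrite pairing_facet_vec; have := cone_coords x abc.
move: (pairing _ _) (pairing _ _) (pairing _ _) h1 h2 h3 => m l k k0 l0 m0 E le1.
have : weighted [:: 0; vec a; vec b; vec c] 1 x.
  exists (1 - (k + l + m)); first by rewrite subr_ge0.
  exists k => //; exists l => //; exists m => //; split; first by ring.
  by rewrite scaler0 subr0 E; exact: cancel3.
have h0 v : v \in [:: 0; vec a; vec b; vec c] -> hull (pts V) v.
  by rewrite !inE => /or4P[] /eqP ->;
    [exact: hull0|apply: sub_hull; apply: pts_vec..].
move/(weighted_hull (@hull_closed _ _ (pts V)) h0 ltr01).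
by rewrite invr1 scale1r.
Qed.

(** In a unimodular cone lattice points have integral coordinates, and below the
    facet only the origin and the generators remain. *)
Lemma hull_lattice (x : 'rV[R]_3) :
  hull (pts V) x -> lattice x -> x = 0 \/ pts V x.
Proof.
move=> hx /latticeP[v vE].
have [a [b [c [abc h1 h2 h3]]]] := cone_cover x.
have [_ aV bV cV _] := facet_tripleP _ _ _ _ abc.
have := hull_facet_le1 abc hx; rewrite pairing_facet_vec.
have := cone_coords x abc; move: h1 h2 h3.
rewrite vE !pairing_vec.
move: (dot _ _) (dot _ _) (dot _ _) => m l k.
rewrite !(realZ_le 0) -!realZD (realZ_le _ 1) => k0 l0 m0 E le1.
have : [\/ [/\ k = 0, l = 0 & m = 0]%Z, [/\ k = 1, l = 0 & m = 0]%Z,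
  [/\ k = 0, l = 1 & m = 0]%Z | [/\ k = 0, l = 0 & m = 1]%Z].
  have [?|?] : (k = 0 \/ k = 1)%Z by lia.
    have [?|?] : (l = 0 \/ l = 1)%Z by lia.
      have [?|?] : (m = 0 \/ m = 1)%Z by lia.
        by constructor 1.
      by constructor 4.
    by constructor 3; split; lia.
  by constructor 2; split; lia.
case=> [] [k' l' m']; move: E; rewrite {}k' {}l' {}m' ?(realZ0, realZ1).
all: rewrite ?(scale0r, scale1r) ?(addr0, add0r) => ->.
- by left.
- by right; exact: pts_vec.
- by right; exact: pts_vec.
- by right; exact: pts_vec.
Qed.

End Fan.
End Embedding.

(** * The vertices of a reflexive polytope *)

Lemma cross_eq0_orthogonal a b :
  cross a b = (0, 0, 0)%Z -> forall x, dot b (cross a x) = 0%Z.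
Proof.
move=> ab x; have -> : dot b (cross a x) = (- dot x (cross a b))%Z.
  by clear; move: a b x; ptring.
by rewrite ab; case: x => [[? ?] ?] /=; lia.
Qed.

Lemma exists_cross_neq0 a :
  a <> (0, 0, 0)%Z -> exists x, cross a x <> (0, 0, 0)%Z.
Proof.
case: a => [[x y] z] a0; apply: contrapT => /forallNP h; apply: a0.
have /contrapT := h (1, 0, 0)%Z; have /contrapT := h (0, 1, 0)%Z.
by move=> /= [? ? ?] [? ? ?]; congr (_, _, _); lia.
Qed.

(** The common normal is the cross product of two independent vectors of [s] or,
    if there are none, of a nonzero one and any vector not parallel to it. *)
Lemma independent_triple_or_normal (s : seq pt) :
  (exists a b c, [/\ a \in s, b \in s, c \in s & det a b c <> 0%Z]) \/
  (exists2 d, d <> (0, 0, 0)%Z & forall v, v \in s -> dot v d = 0%Z).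
Proof.
have [[a [b [as_ bs ab]]]|no2] :=
    pselect (exists a b, [/\ a \in s, b \in s & cross a b <> (0, 0, 0)%Z]).
  have [[c cs D]|no3] := pselect (exists2 c, c \in s & det c a b <> 0%Z).
    by left; exists c, a, b.
  right; exists (cross a b) => // v vs; apply: contrapT => D.
  by apply: no3; exists v.
right; have [[a as_ a0]|no1] := pselect (exists2 a, a \in s & a <> (0, 0, 0)%Z).
  have [x ax] := exists_cross_neq0 a0; exists (cross a x) => // v vs.
  apply: cross_eq0_orthogonal; apply: contrapT => av.
  by apply: no2; exists a, v.
exists (1, 0, 0)%Z => // v vs; have [->//|v0] := pselect (v = (0, 0, 0)%Z).
by case: no1; exists v.
Qed.

Section Reflexive.
Context {R : realType}.
Local Notation hull := Defs.conv.
Implicit Types (P : set 'rV[R]_3) (V : seq pt).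

Lemma vertex_comb A (x a b c : 'rV[R]_3) (k l m : R) :
  vertices A x -> A a -> A b -> A c -> 0 < k -> 0 <= l -> 0 <= m ->
  k + l + m = 1 -> x = k *: a + l *: b + m *: c -> a = x.
Proof.
move=> [u [e [h E]]] Aa Ab Ac k0 l0 m0 klm xE.
have [_ xe] : (A `&` [set x | pairing x u = e]) x by rewrite -E.
suff ae : pairing a u = e by have : [set x] a by rewrite E.
have := h a Aa; have := h b Ab; have := h c Ac; have := xe.
rewrite /= xE !pairingDl !pairingZl.
move: (pairing a u) (pairing b u) (pairing c u) => p q r E1 hr hq hp.
apply/eqP; rewrite eq_le hp andbT -(ler_pM2l k0).
have : 0 <= l * (q - e) by rewrite mulr_ge0 // subr_ge0.
have : 0 <= m * (r - e) by rewrite mulr_ge0 // subr_ge0.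
have : k * e + l * e + m * e = e by rewrite -!mulrDl klm mul1r.
lra.
Qed.

Lemma vertex_midpoint A (x d : 'rV[R]_3) :
  vertices A x -> A (x + d) -> A (x - d) -> d = 0.
Proof.
move=> [u [e [h E]]] Ap Am.
have [_ xe] : (A `&` [set x | pairing x u = e]) x by rewrite -E.
have : [set x] (x + d).
  rewrite E; split=> //; have := h _ Ap; have := h _ Am; move: xe.
  by rewrite /= !pairingDl pairingNl; lra.
by move/eqP; rewrite -subr_eq0 addrC addKr => /eqP.
Qed.

Lemma lattice_seq (s : seq 'rV[R]_3) :
  (forall x, x \in s -> lattice x) -> exists V, s = map vec V.
Proof.
elim: s => [|x s IH] h; first by exists [::].
have [|V ->] := IH; first by move=> y ys; apply: h; rewrite inE ys orbT.
have /latticeP[v ->] := h x (mem_head _ _).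
by exists (v :: V).
Qed.

Lemma lattice_polytope_vertices P : lattice_polytope P ->
  exists V, [/\ uniq V, P = hull (pts V) & vertices P = pts V].
Proof.
move=> [[S /finite_seqP[s ->] ->]] sub.
have [W [uW hW vW]] := polytope_vertices s.
have [|V WV] := @lattice_seq W.
  by move=> x xW; apply: sub; rewrite vW.
exists V; rewrite /pts -WV vW hW; split=> //.
by move: uW; rewrite WV map_inj_uniq //; exact: vec_inj.
Qed.

Lemma interior_scale P (y : 'rV[R]_3) :
  interior P 0 -> exists2 k : R, 0 < k & P (k *: y).
Proof.
move=> /nbhs_norm0P[e /= e0 h]; have y0 : 0 < `|y| + 1 by rewrite ltr_wpDl.
exists (e / (`|y| + 1)); first by rewrite divr_gt0.
apply: h => /=; rewrite normrZ ger0_norm ?divr_ge0 ?(ltW e0) ?(ltW y0) //.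
by rewrite mulrAC ltr_pdivrMr // ltr_pM2l // ltrDl.
Qed.

Lemma seq_dot_bound V d : exists2 N, (0 < N)%Z &
  forall v, v \in V -> (- N <= dot v d <= N)%Z.
Proof.
elim: V => [|v V [N N0 h]]; first by exists 1%Z.
exists (N + Z.abs (dot v d))%Z; first by lia.
by move=> u; rewrite inE => /predU1P[->|/h]; lia.
Qed.

Variables (P : set 'rV[R]_3) (V : seq pt).
Hypotheses (P_reflexive : reflexive_polytope P) (P_hull : P = hull (pts V))
  (P_vertices : vertices P = pts V).

Let P_interior : interior P 0. Proof. by case: P_reflexive. Qed.

Lemma reflexive_pts v : v \in V -> P (vec v).
Proof. by move=> vV; rewrite P_hull; apply: sub_hull; exact: pts_vec. Qed.

Lemma reflexive0 : P 0.
Proof. exact: interior_subset P_interior. Qed.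

Lemma dual_reflexiveP y :
  dual P y <-> forall v, v \in V -> -1 <= pairing (vec v) y.
Proof.
split=> [h v /reflexive_pts /h //|h x]; rewrite P_hull.
by apply: hull_ge => _ /ptsP[v vV ->]; exact: h.
Qed.

(** A negative multiple of the vector [f] is a point of [P], on which the form
    [f] is negative. *)
Lemma exists_negative (f : pt) :
  f <> (0, 0, 0)%Z -> exists2 v, v \in V & (dot v f < 0)%Z.
Proof.
move=> f0; apply: contrapT => /forall2NP h.
have [k k0] := interior_scale (- vec f) P_interior; rewrite P_hull.
have ge0 (v : 'rV[R]_3) : pts V v -> 0 <= pairing v (vec f).
  move=> /ptsP[w wV ->]; rewrite pairing_vec (realZ_le 0).
  by have [/(_ wV)//|] := h w; lia.
move=> /(hull_ge ge0); rewrite pairingZl pairingNl pmulr_rge0 // oppr_ge0.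
apply/negP; rewrite -ltNge; apply: pairing_gt0.
by apply/eqP; rewrite -vec0 => /vec_inj.
Qed.

Lemma dual_vec_neq0 a b c : det a b c <> 0%Z -> dual_vec a b c <> (0, 0, 0)%Z.
Proof.
move=> D E; have := dot_dual_fst a b c; rewrite E.
have -> : dot a (0, 0, 0)%Z = 0%Z by clear; case: a => [[? ?] ?] /=; lia.
by move/esym/Z.mul_eq_0 => []; exact: D.
Qed.

(** The plane of a facet triple is a vertex of the dual polytope, exposed by the
    sum of the triple, so that it is defined by an integral form. *)
Lemma facet_integral a b c : facet_triple V a b c ->
  exists u, facet_vec a b c = scale (det a b c * det a b c)%Z u.
Proof.
move=> /facet_tripleP[D aV bV cV le].
have D2 : 0 < realZ (det a b c * det a b c)%Z :> R by rewrite (realZ_lt 0); nia.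
pose w : 'rV[R]_3 :=
  - (realZ (det a b c * det a b c)%Z)^-1 *: vec (facet_vec a b c).
have wE v : pairing (vec v) w = - (realZ (dot v (facet_vec a b c)) /
    realZ (det a b c * det a b c)%Z).
  by rewrite pairingZr pairing_vec mulNr mulrC.
have dw : dual P w.
  apply/dual_reflexiveP => v /le h; rewrite wE lerN2 ler_pdivrMr // mul1r.
  by rewrite realZ_le; lia.
have w1 v : dot v (facet_vec a b c) = (det a b c * det a b c)%Z ->
    pairing (vec v) w = -1.
  by move=> E; rewrite wE E divff // gt_eqF.
have wa := w1 a (dot_facet_fst a b c).
have wb := w1 b (dot_facet_snd a b c).
have wc := w1 c (dot_facet_trd a b c).
have [_ _ _ [_ sub]] := P_reflexive.
have : vertices (dual P) w.
  exists (vec a + vec b + vec c), (- 3%:R); split.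
    move=> y /dual_reflexiveP h; rewrite !(pairingDr _ _ y) !(pairingC y).
    by have := h _ aV; have := h _ bV; have := h _ cV; lra.
  apply/seteqP; split=> y /=.
    move=> ->; split=> //; rewrite !(pairingDr _ _ w) !(pairingC w) wa wb wc.
    by ring.
  move=> [/dual_reflexiveP h]; rewrite !(pairingDr _ _ y) !(pairingC y) => E.
  have := h _ aV; have := h _ bV; have := h _ cV => hc hb ha.
  apply/eqP; rewrite -subr_eq0; apply/eqP.
  apply: (orthogonal_eq0 D);
    rewrite pairingDl pairingNl !(pairingC y) !(pairingC w) ?wa ?wb ?wc; lra.
move=> /sub/latticeP[u uE]; exists (opp u); apply: (@vec_inj R).
rewrite vecZ vecN -uE /w scaleNr opprK scalerA divff ?scale1r //.
by rewrite gt_eqF.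
Qed.

(** Take a vertex [u] of the dual polytope. If the vertices of [P] on the plane
    of [u] had a common normal [d], a small multiple of [d] could be both added
    to [u] and subtracted from it inside the dual polytope, which is impossible
    at a vertex. *)
Lemma exists_facet_triple : exists a b c, facet_triple V a b c.
Proof.
have [_ _ _ dP] := P_reflexive.
have [U [_ hU vU]] := lattice_polytope_vertices dP.
have [u uU] : exists u, u \in U.
  case: (U) hU => [|u U' _]; last by exists u; rewrite mem_head.
  move=> hU; have : dual P 0 by move=> x _; rewrite pairing0r lerN10.
  by rewrite hU => /(hull_sub (C := set0)); case=> // ? [].
have du : dual P (vec u) by rewrite hU; apply: sub_hull; exact: pts_vec.
have ge v : v \in V -> (-1 <= dot v u)%Z.
  move=> /reflexive_pts/du; rewrite pairing_vec -(realZN 1) realZ_le.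
  by lia.
pose Vu := [seq v <- V | dot v u == -1%Z].
have [[a [b [c []]]]|[d d0 dVu]] := independent_triple_or_normal Vu.
  rewrite !mem_filter => /andP[/eqP ua aV] /andP[/eqP ub bV] /andP[/eqP uc cV] D.
  have E : facet_vec a b c = scale (- (det a b c * det a b c))%Z u.
    apply: (@vec_inj R); apply/eqP; rewrite -subr_eq0; apply/eqP.
    apply: (orthogonal_eq0 D); rewrite pairingDl pairingNl !pairing_vec.
    - apply/eqP; rewrite subr_eq0 -!pairing_vec !(pairingC _ (vec a)) !pairing_vec.
      by rewrite dot_facet_fst dot_scale ua; apply/eqP; congr realZ; lia.
    - apply/eqP; rewrite subr_eq0 -!pairing_vec !(pairingC _ (vec b)) !pairing_vec.
      by rewrite dot_facet_snd dot_scale ub; apply/eqP; congr realZ; lia.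
    - apply/eqP; rewrite subr_eq0 -!pairing_vec !(pairingC _ (vec c)) !pairing_vec.
      by rewrite dot_facet_trd dot_scale uc; apply/eqP; congr realZ; lia.
  exists a, b, c; apply/facet_tripleP; split=> // v /ge h.
  by rewrite E dot_scale; nia.
have [N N0 bound] := seq_dot_bound V d; exfalso.
have N0' : 0 < realZ N :> R by rewrite (realZ_lt 0); lia.
have move_dual (s : R) : `|s| = (realZ N)^-1 -> dual P (vec u + s *: vec d).
  move=> sN; apply/dual_reflexiveP => v vV.
  rewrite pairingDr pairingZr !pairing_vec.
  have [uv|uv] := eqVneq (dot v u) (-1)%Z.
    rewrite uv dVu ?mem_filter ?uv // mulr0 addr0.
    by rewrite [realZ _](realZN 1).
  have uv0 : 0 <= realZ (dot v u) :> R.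
    by rewrite (realZ_le 0); have := ge v vV; move/eqP: uv; lia.
  suff : `|s * realZ (dot v d)| <= 1.
    by rewrite ler_norml => /andP[? _]; rewrite -[leLHS]add0r lerD.
  rewrite normrM sN ler_pdivrMl // mulr1 ler_norml -realZN !realZ_le.
  by have := bound v vV; lia.
have n1 : `|(realZ N)^-1 : R| = (realZ N)^-1 by rewrite ger0_norm // invr_ge0 ltW.
have n2 : `|- (realZ N)^-1 : R| = (realZ N)^-1 by rewrite normrN.
have vu : vertices (dual P) (vec u) by rewrite vU; exact: pts_vec.
have := vertex_midpoint vu (move_dual _ n1).
rewrite -scaleNr => /(_ (move_dual _ n2)) /eqP.
rewrite scaler_eq0 invr_eq0 gt_eqF //= => /eqP.
by rewrite -vec0 => /vec_inj.
Qed.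

End Reflexive.

(** * Terminality and unimodular facets *)

Lemma dot_facet_frame a b c x :
  dot (frame a b c x) (facet_vec a b c) =
  (det a b c * det a b c * dot (1, 1, 1) x)%Z.
Proof. move: a b c x; ptring. Qed.

Lemma frame_cyc a b c x y z : frame a b c (x, y, z) = frame b c a (y, z, x).
Proof. move: a b c; ptring. Qed.

Lemma frame_remainder a b c M q1 q2 q3 r1 r2 r3 :
  add (frame a b c (M * q1 + r1, M * q2 + r2, M * q3 + r3)%Z)
      (opp (scale M (frame a b c (q1, q2, q3)))) = frame a b c (r1, r2, r3).
Proof. move: a b c; ptring. Qed.

Lemma frame_complement a b c M r1 r2 r3 :
  add (scale M (add (add a b) c)) (opp (frame a b c (r1, r2, r3))) =
  frame a b c (M - r1, M - r2, M - r3)%Z.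
Proof. move: a b c; ptring. Qed.

Lemma scale_add_opp k x y :
  scale k (add x (opp y)) = add (scale k x) (opp (scale k y)).
Proof. move: x y; ptring. Qed.

Section Terminal.
Context {R : realType}.
Local Notation hull := Defs.conv.
Variables (P : set 'rV[R]_3) (V : seq pt).
Hypotheses (P_reflexive : reflexive_polytope P) (P_hull : P = hull (pts V))
  (P_vertices : vertices P = pts V).

Lemma vertex0 : (0, 0, 0)%Z \notin V.
Proof.
apply/negP => V0; have [_ _ int0 _] := P_reflexive.
have v0 : vertices P 0 by rewrite P_vertices -vec0; exact: pts_vec.
have [k k0 Pk] := interior_scale (vec e1) int0.
have [l l0 Pl] := interior_scale (- vec e1) int0.
have kl : 0 < k + l by rewrite addr_gt0.
have E : k *: vec e1 = 0 :> 'rV[R]_3.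
  apply: (vertex_comb v0 Pk Pl Pl
    (k := l / (k + l)) (l := k / (k + l)) (m := 0)) => //.
  - by rewrite divr_gt0.
  - by rewrite divr_ge0 ?ltW.
  - by rewrite addr0 -mulrDl addrC divff // gt_eqF.
  - rewrite scale0r addr0 !scalerA scalerN -scalerBl (_ : _ - _ = 0) ?scale0r //.
    by ring.
move/eqP: E; rewrite scaler_eq0 gt_eqF //= -vec0 => /eqP/vec_inj.
by [].
Qed.

Lemma unimodular_terminal : unimodular_hull V -> terminal P.
Proof.
move=> uV; have [a [b [c abc]]] := exists_facet_triple P_reflexive P_hull.
rewrite /terminal P_vertices; apply/seteqP; split=> x.
  by move=> [Px lx]; apply: (hull_lattice uV abc) lx; rewrite -P_hull.
move=> [->|/ptsP[v vV ->]].
  split; first exact: reflexive0 P_reflexive.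
  by rewrite -vec0; exact: vec_lattice.
by split; [exact: (reflexive_pts P_hull)|exact: vec_lattice].
Qed.

Hypothesis P_terminal : terminal P.

Lemma lattice_pt v : P (vec v) -> v = (0, 0, 0)%Z \/ v \in V.
Proof.
move=> Pv; have : ([set 0] `|` vertices P) (vec v).
  by rewrite -P_terminal; split=> //; exact: vec_lattice.
case=> [|]; first by rewrite /= -vec0 => /vec_inj; left.
by rewrite P_vertices => /ptsP[w wV /vec_inj ->]; right.
Qed.

Lemma half_double (x : 'rV[R]_3) : (1 / 2) *: (x + x) = x.
Proof. by rewrite scalerDr -scalerDl (_ : 1 / 2 + 1 / 2 = 1) ?scale1r //; lra. Qed.

Lemma terminal_parity_free : parity_free V.
Proof.
have half : 0 < (1 / 2 : R) by lra.
have P0 := reflexive0 P_reflexive.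
split=> [a m aV aE|a b m aV bV abE].
  have mE : vec a = vec m + vec m :> 'rV[R]_3 by rewrite aE vecD.
  have a0 : a <> (0, 0, 0)%Z by move=> E; have := vertex0; rewrite -E aV.
  have Pa := reflexive_pts P_hull aV.
  have Pm : P (vec m).
    rewrite P_hull; rewrite P_hull in Pa P0.
    have -> : vec m = (1 / 2) *: vec a + (1 - 1 / 2) *: 0 :> 'rV[R]_3.
      by rewrite scaler0 addr0 mE half_double.
    by apply: hull_closed => //; lra.
  have [m0|mV] := lattice_pt Pm; first by apply: a0; rewrite aE m0.
  have vm : vertices P (vec m) by rewrite P_vertices; exact: pts_vec.
  have m0 : vec m = 0 :> 'rV[R]_3.
    by apply: (vertex_midpoint vm); rewrite ?subrr // -mE.
  by apply: a0; apply: (@vec_inj R); rewrite mE m0 vec0 addr0.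
have mE : vec a + vec b = vec m + vec m :> 'rV[R]_3 by rewrite -!vecD abE.
have Pa := reflexive_pts P_hull aV; have Pb := reflexive_pts P_hull bV.
have Pm : P (vec m).
  rewrite P_hull; rewrite P_hull in Pa Pb.
  have -> : vec m = (1 / 2) *: vec a + (1 - 1 / 2) *: vec b :> 'rV[R]_3.
    rewrite (_ : 1 - 1 / 2 = 1 / 2); last by lra.
    by rewrite -scalerDr mE half_double.
  by apply: hull_closed => //; lra.
have [m0|mV] := lattice_pt Pm.
  right; apply: (@vec_inj R); rewrite vecN; apply/eqP; rewrite -addr_eq0 addrC mE.
  by rewrite m0 vec0 addr0.
left; have vm : vertices P (vec m) by rewrite P_vertices; exact: pts_vec.
have am : vec a - vec m = 0 :> 'rV[R]_3.
  apply: (vertex_midpoint vm); first by rewrite addrC subrK.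
  by rewrite opprB addrA -mE addrAC subrr add0r.
move/eqP: am; rewrite subr_eq0 => /eqP am.
apply: (@vec_inj R); move: mE; rewrite am => /addrI ->.
by [].
Qed.

(** A lattice point of the triangle is a vertex of [P] by terminality, and a
    vertex is not a convex combination of other points of [P]. The first
    coordinate, being positive, identifies it as [a]; being less than [M], it
    contradicts that. *)
Lemma no_lattice_point_in_triple a b c z r1 r2 r3 :
  facet_triple V a b c ->
  let M := (det a b c * det a b c)%Z in
  scale M z = frame a b c (r1, r2, r3) ->
  (0 < r1 < M)%Z -> (0 <= r2 < M)%Z -> (0 <= r3 < M)%Z ->
  (r1 + r2 + r3 = M)%Z -> False.
Proof.
move=> abc M zE h1 h2 h3 sum.
have [D aV bV cV _] := facet_tripleP _ _ _ _ abc.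
have M0 : 0 < realZ M :> R by rewrite (realZ_lt 0); lia.
have Mn : realZ M != 0 :> R by rewrite gt_eqF.
have Pa := reflexive_pts P_hull aV; have Pb := reflexive_pts P_hull bV.
have Pc := reflexive_pts P_hull cV.
pose k (r : Z) : R := realZ r / realZ M.
have zE' : vec z = k r1 *: vec a + k r2 *: vec b + k r3 *: vec c :> 'rV[R]_3.
  apply: (scalerI Mn); rewrite -vecZ zE /= !vecD !vecZ !scalerDr !scalerA.
  by rewrite /k ![_ / _]mulrC !mulrA !divff // !mul1r.
have k0 r : (0 <= r)%Z -> 0 <= k r.
  by move=> r0; rewrite divr_ge0 ?(ltW M0) // (realZ_le 0); lia.
have k1 : 0 < k r1 by rewrite divr_gt0 // (realZ_lt 0); lia.
have ksum : k r1 + k r2 + k r3 = 1.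
  by rewrite /k -!mulrDl -!realZD sum divff.
have Pz : P (vec z).
  rewrite P_hull; rewrite P_hull in Pa Pb Pc.
  by rewrite zE'; apply: hull3 => //; apply: k0; lia.
have [u uE] := facet_integral P_reflexive P_hull abc.
have [z0|zV] := lattice_pt Pz.
  have := congr1 (dot^~ (facet_vec a b c)) zE.
  rewrite z0 dot_facet_frame -/M.
  have -> : dot (scale M (0, 0, 0)%Z) (facet_vec a b c) = 0%Z.
    by rewrite dot_scalel; case: (facet_vec a b c) => [[? ?] ?] /=; lia.
  have -> : dot (1, 1, 1)%Z (r1, r2, r3) = M by rewrite /= -sum; lia.
  by move/esym/Z.mul_eq_0; lia.
have vz : vertices P (vec z) by rewrite P_vertices; exact: pts_vec.
have az : a = z.
  apply: (@vec_inj R); apply: (vertex_comb vz Pa Pb Pc k1 _ _ ksum zE').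
    by apply: k0; lia.
  by apply: k0; lia.
have := congr1 (fun x => (coords a b c x).1.1) zE; rewrite -az coords_frame_det.
rewrite /= dot_scalel dot_dual_fst -/M => E.
by have : (M = r1)%Z by [nia]; lia.
Qed.

(** The fractional parts [r1 / M], [r2 / M], [r3 / M] of the coordinates of [z]
    in the basis of the triple are the coordinates of a lattice point [w]. Its
    height, their sum, is an integer below 3. Height 1 puts [w] in the triangle,
    height 2 does so for [a + b + c - w], and height 0 is the claim. *)
Lemma facet_triple_coords_dvd a b c z : facet_triple V a b c ->
  exists q, coords a b c z = scale (det a b c * det a b c)%Z q.
Proof.
move=> abc; pose M := (det a b c * det a b c)%Z.
have [D _ _ _ _] := facet_tripleP _ _ _ _ abc.
have M0 : (0 < M)%Z by rewrite /M; nia.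
have [u uE] := facet_integral P_reflexive P_hull abc.
have bca := facet_triple_cyc abc.
have MB : (det b c a * det b c a)%Z = M by rewrite det_cyc.
have none w r1 r2 r3 : scale M w = frame a b c (r1, r2, r3) ->
    (0 <= r1 < M)%Z -> (0 <= r2 < M)%Z -> (0 <= r3 < M)%Z ->
    (r1 + r2 + r3 = M)%Z -> False.
  move=> wE h1 h2 h3 sum.
  have [p1|n1] := Z_lt_le_dec 0 r1.
    by apply: (no_lattice_point_in_triple abc wE) => //; lia.
  have [p2|n2] := Z_lt_le_dec 0 r2.
    apply: (@no_lattice_point_in_triple b c a w r2 r3 r1 bca);
      rewrite ?MB //; try lia.
    by rewrite wE frame_cyc.
  by lia.
have := frame_coords_det a b c z; rewrite -/M.
case: (coords a b c z) (erefl (coords a b c z)) => [[x1 x2] x3] xE zE.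
have d1 := Z.div_mod x1 M; have d2 := Z.div_mod x2 M; have d3 := Z.div_mod x3 M.
have m1 := Z.mod_pos_bound x1 M M0; have m2 := Z.mod_pos_bound x2 M M0.
have m3 := Z.mod_pos_bound x3 M M0.
set r1 := (x1 mod M)%Z in d1 m1; set r2 := (x2 mod M)%Z in d2 m2.
set r3 := (x3 mod M)%Z in d3 m3.
set q1 := (x1 / M)%Z in d1; set q2 := (x2 / M)%Z in d2; set q3 := (x3 / M)%Z in d3.
pose w := add z (opp (frame a b c (q1, q2, q3))).
have wE : scale M w = frame a b c (r1, r2, r3).
  rewrite scale_add_opp.
  have e1 : (x1 = M * q1 + r1)%Z by lia.
  have e2 : (x2 = M * q2 + r2)%Z by lia.
  have e3 : (x3 = M * q3 + r3)%Z by lia.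
  by rewrite -zE e1 e2 e3; exact: frame_remainder.
have hE : (r1 + r2 + r3 = M * dot w u)%Z.
  have := congr1 (dot^~ (facet_vec a b c)) wE.
  rewrite dot_facet_frame uE dot_scalel dot_scale -/M.
  have -> : dot (1, 1, 1)%Z (r1, r2, r3) = (r1 + r2 + r3)%Z by rewrite /=; lia.
  by move/Z.mul_reg_l => <- //; lia.
have h012 : (dot w u = 0 \/ dot w u = 1 \/ dot w u = 2)%Z by nia.
case: h012 => [h|[h|h]]; rewrite h in hE.
- exists (q1, q2, q3) => /=; congr (_, _, _); lia.
- by case: (none _ _ _ _ wE m1 m2 m3); lia.
- case: (none (add (add (add a b) c) (opp w))
    (M - r1)%Z (M - r2)%Z (M - r3)%Z); try lia.
  by rewrite scale_add_opp wE; exact: frame_complement.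
Qed.

(** With [d] for the determinant of the triple, [d ^ 2] divides the matrix of
    the coordinates of the standard basis, whose determinant is [d ^ 5]; so [d]
    divides [1]. *)
Lemma terminal_facet_det a b c :
  facet_triple V a b c -> (det a b c * det a b c = 1)%Z.
Proof.
move=> abc; have [D _ _ _ _] := facet_tripleP _ _ _ _ abc.
have [q1 E1] := facet_triple_coords_dvd e1 abc.
have [q2 E2] := facet_triple_coords_dvd e2 abc.
have [q3 E3] := facet_triple_coords_dvd e3 abc.
have : det (coords a b c e1) (coords a b c e2) (coords a b c e3) =
    (det a b c * (det a b c * det a b c * (det a b c * det a b c)))%Z.
  by clear; move: a b c; ptring.
rewrite E1 E2 E3.
move: (det a b c) D => d d0.
have -> : det (scale (d * d) q1) (scale (d * d) q2) (scale (d * d) q3) =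
    (d * d * (d * d) * (d * d) * det q1 q2 q3)%Z.
  by clear; move: q1 q2 q3; ptring.
move: (det q1 q2 q3) => e E.
have : (d * e = 1)%Z.
  apply: (Z.mul_reg_l _ _ (d * d * d * d * d)%Z); first by nia.
  by rewrite Z.mul_1_r -[RHS]Z.mul_assoc; move: E; lia.
move=> /Z.mul_eq_1; lia.
Qed.

Lemma terminal_unimodular : unimodular_hull V.
Proof.
move=> a b c abc; split; first exact: terminal_facet_det.
have [D _ _ _ _] := facet_tripleP _ _ _ _ abc.
exact: exists_negative P_reflexive P_hull _ (dual_vec_neq0 D).
Qed.

End Terminal.

Section HullReflexive.
Context {R : realType}.
Local Notation hull := Defs.conv.
Variables (V : seq pt) (a0 b0 c0 : pt).
Hypotheses (V_unimodular : unimodular_hull V) (triple0 : facet_triple V a0 b0 c0).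

Let P : set 'rV[R]_3 := hull (pts V).

Lemma pts_polytope s : polytope (hull (@pts R s)).
Proof. by exists (pts s) => //; exact: finite_seq. Qed.

Lemma vertices_pts_lattice s : vertices (hull (@pts R s)) `<=` lattice.
Proof. by move=> x /vertex_hull/mapP[v _ ->]; exact: vec_lattice. Qed.

Lemma near0_pairing_le1 (y : 'rV[R]_3) :
  \forall x \near (0 : 'rV[R]_3), pairing x y <= 1.
Proof.
have c i : {for (0 : 'rV[R]_3), continuous (fun x : 'rV[R]_3 => x 0 i * y 0 i)}.
  apply: (@continuousM R _ (fun x : 'rV[R]_3 => x 0 i) (fun=> y 0 i)).
    exact: coord_continuous.
  exact: cst_continuous.
have cont : {for (0 : 'rV[R]_3), continuous (fun x : 'rV[R]_3 => pairing x y)}.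
  rewrite (_ : (fun x => _) = (fun x : 'rV[R]_3 =>
      x 0 0 * y 0 0 + x 0 1 * y 0 1 + x 0 2%:R * y 0 2%:R)); last first.
    by apply/funext => x; exact: pairing3.
  exact: continuousD (continuousD (c 0) (c 1)) (c 2%:R).
have : pairing 0 y < 1 by rewrite pairing0l.
by move/(cvgr_lt _ cont); apply: filterS => x /ltW.
Qed.

Lemma hull_interior0 : interior P 0.
Proof.
have [e e0 he] : exists2 e : R, 0 < e & forall x : 'rV[R]_3, `|x| < e ->
    forall t, t \in facet_triples V ->
    pairing x (vec (facet_vec t.1.1 t.1.2 t.2)) <= 1.
  elim: (facet_triples V) => [|t T [e e0 IH]]; first by exists 1.
  have /nbhs_norm0P[e' /= e'0 h] :=
    near0_pairing_le1 (vec (facet_vec t.1.1 t.1.2 t.2)).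
  exists (Num.min e e'); first by rewrite lt_min e0.
  move=> x; rewrite lt_min => /andP[xe xe'] u; rewrite inE => /predU1P[->|].
    exact: h.
  exact: IH.
suff : \forall x \near (0 : 'rV[R]_3), P x by [].
apply/nbhs_norm0P; exists e => //= x /he h.
apply/(hullP V_unimodular triple0) => a b c abc.
by apply: (h (a, b, c)); rewrite mem_facet_triples.
Qed.

(** A form that is at least [-1] on all of [P] is a convex combination of the
    facet forms, as any point separating it from them would, after scaling, be a
    point of [P] on which it is below [-1]. *)
Lemma dual_hull : dual P =
  hull (pts [seq opp (facet_vec t.1.1 t.1.2 t.2) | t <- facet_triples V]).
Proof.
apply/seteqP; split=> y.
  move=> dy; apply: contrapT => /separation[x [e [he hy]]].
  have hx a b c : facet_triple V a b c ->
      pairing x (vec (facet_vec a b c)) <= - e.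
    move=> abc; rewrite lerNr -pairingNr -vecN pairingC; apply: he.
    by apply/map_f/mapP; exists (a, b, c); rewrite ?mem_facet_triples.
  have [e0|e0] := ltP e 0.
    have Px : P ((- e)^-1 *: x).
      apply/(hullP V_unimodular triple0) => a b c /hx h.
      by rewrite pairingZl ler_pdivrMl ?oppr_gt0 // mulr1.
    have := dy _ Px; rewrite pairingZl ler_pdivlMl ?oppr_gt0 //.
    by rewrite mulrN1 opprK pairingC leNgt hy.
  have [a [b [c [abc h1 h2 h3]]]] := cone_cover V_unimodular triple0 x.
  have := hx _ _ _ abc; rewrite pairing_facet_vec => sum.
  have := cone_coords V_unimodular x abc.
  have -> : pairing x (vec (dual_vec a b c)) = 0 by apply/eqP; lra.
  have -> : pairing x (vec (dual_vec b c a)) = 0 by apply/eqP; lra.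
  have -> : pairing x (vec (dual_vec c a b)) = 0 by apply/eqP; lra.
  rewrite !scale0r !addr0 => x0.
  by have : pairing y x = 0; [rewrite x0 pairing0r|lra].
move=> hy x Px; rewrite pairingC; apply: hull_ge hy => _ /ptsP[w wT ->].
move: wT => /mapP[[[a b] c]]; rewrite mem_facet_triples => abc ->.
rewrite vecN pairingNl lerN2 pairingC.
exact: (hull_facet_le1 V_unimodular abc).
Qed.

Lemma edge_mx_unit a b c (v : 'I_4 -> 'rV[R]_3) : facet_triple V a b c ->
  v ord0 = 0 -> v (lift ord0 0) = vec a -> v (lift ord0 1) = vec b ->
  v (lift ord0 2%:R) = vec c -> edge_mx v \in unitmx.
Proof.
move=> abc v0 v1 v2 v3.
pose B : 'M[R]_3 := \matrix_(i, j)
  vec (if j == 0 then dual_vec a b c else if j == 1 then dual_vec b c a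
       else dual_vec c a b) 0 i.
suff /mulmx1_unit[] : edge_mx v *m B = 1%:M by [].
have D := facet_det V_unimodular abc.
have D2 : (det b c a * det b c a)%Z = 1%Z by rewrite (det_cyc a b c).
have D3 : (det c a b * det c a b)%Z = 1%Z.
  by rewrite (det_cyc b c a) (det_cyc a b c).
have E i j : (edge_mx v *m B) i j = pairing (v (lift ord0 i)) (vec
    (if j == 0 then dual_vec a b c else if j == 1 then dual_vec b c a
     else dual_vec c a b)).
  by rewrite mxE; apply: eq_bigr => k _; rewrite !mxE v0 mxE subr0.
apply/matrixP => i j; rewrite E [RHS]mxE; move: j i.
apply: ord3P; apply: ord3P; rewrite ?v1 ?v2 ?v3 /= pairing_vec.
all: by rewrite ?dot_dual_fst ?dot_dual_cyc ?dot_dual_last ?D ?D2 ?D3.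
Qed.

Lemma hull_has_dim : has_dim P 3.
Proof.
pose v (i : 'I_4) : 'rV[R]_3 := nth 0 [:: 0; vec a0; vec b0; vec c0] i.
have u : edge_mx v \in unitmx by apply: edge_mx_unit triple0 _ _ _ _.
have [_ aV bV cV _] := facet_tripleP _ _ _ _ triple0.
exists v; split.
- by rewrite /affinely_independent row_free_unit.
- have P0 : P 0 by exact: hull0 V_unimodular triple0.
  case=> [[|[|[|[|//]]]] hi] //=; apply: sub_hull; exact: pts_vec.
- by move=> x _; apply: submx_full; rewrite row_full_unit.
Qed.

Lemma hull_reflexive : reflexive_polytope P.
Proof.
split.
- by split; [exact: pts_polytope|exact: vertices_pts_lattice].
- exact: hull_has_dim.
- exact: hull_interior0.
- by rewrite dual_hull; split; [exact: pts_polytope|exact: vertices_pts_lattice].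
Qed.

End HullReflexive.

(** * Lattice isomorphisms *)

Lemma frame_add p q r x y :
  frame p q r (add x y) = add (frame p q r x) (frame p q r y).
Proof. move: p q r x y; ptring. Qed.

Lemma coords_as_frame a b c x :
  coords a b c x = frame (coords a b c e1) (coords a b c e2) (coords a b c e3) x.
Proof. move: a b c x; ptring. Qed.

Lemma frame_frame p q r a b c x :
  frame p q r (frame a b c x) =
  frame (frame p q r a) (frame p q r b) (frame p q r c) x.
Proof. move: p q r a b c x; ptring. Qed.

Lemma vsum_map_frame p q r s :
  vsum [seq frame p q r v | v <- s] = frame p q r (vsum s).
Proof.
elim: s => [|x s /= ->]; first by move: p q r; ptring.
by rewrite frame_add.
Qed.

Lemma zsum_cat s t : (zsum (s ++ t) = zsum s + zsum t)%Z.
Proof. by elim: s => //= x s ->; lia. Qed.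

Lemma perm_zsum s t : perm_eq s t -> zsum s = zsum t.
Proof.
move=> st.
apply: (catCA_perm_ind (P := fun u => zsum s = zsum u) _ st) => // x y z ->.
by rewrite !zsum_cat; lia.
Qed.

Definition det_form (V : seq pt) (v w : pt) : Z :=
  zsum [seq zsum [seq (det v a b * det w a b)%Z | b <- V] | a <- V].

Lemma zsum_allpairs (f : pt -> Z) V W :
  zsum [seq f n | n <- [seq cross a b | a <- V, b <- W]] =
  zsum [seq zsum [seq f (cross a b) | b <- W] | a <- V].
Proof.
elim: V => //= a V IH; rewrite map_cat zsum_cat IH; congr (_ + _)%Z.
by rewrite -map_comp.
Qed.

Lemma inertia_formE V v w : inertia_form (inertia V) v w = det_form V v w.
Proof.
rewrite /det_form -(zsum_allpairs (fun n => dot v n * dot w n)%Z).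
rewrite /inertia_form /inertia /=; move: [seq _ | _ <- _, _ <- _] => N.
elim: N => [|n N IH] /=; first by move: v w; ptring.
rewrite -IH; move: (vsum _) (vsum _) (vsum _) => x y z.
by clear; move: n x y z v w; ptring.
Qed.

Section InvariantFrame.
Variables p q r : pt.
Hypothesis unit_pqr : (det p q r * det p q r = 1)%Z.

Lemma det_form_frame V v w :
  det_form [seq frame p q r x | x <- V] (frame p q r v) (frame p q r w) =
  det_form V v w.
Proof.
rewrite /det_form -map_comp; congr zsum; apply: eq_map => a /=.
rewrite -map_comp; congr zsum; apply: eq_map => b /=.
rewrite !det_frame.
have -> : (det p q r * det v a b * (det p q r * det w a b) =
  det p q r * det p q r * (det v a b * det w a b))%Z by lia.
by rewrite unit_pqr; lia.
Qed.

Lemma perm_det_form V W v w : perm_eq V W -> det_form V v w = det_form W v w.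
Proof.
move=> VW; rewrite /det_form (perm_zsum (perm_map _ VW)); congr zsum.
by apply: eq_map => a; apply: perm_zsum; apply: perm_map.
Qed.

Lemma invariant_frame V W :
  perm_eq W [seq frame p q r v | v <- V] -> invariant W = invariant V.
Proof.
move=> WV; rewrite /invariant (perm_vsum WV) vsum_map_frame; congr (_, _).
  rewrite (perm_zsum (perm_map _ WV)) -map_comp; congr zsum.
  apply: eq_map => v /=.
  by rewrite !inertia_formE (perm_det_form _ _ WV) det_form_frame.
rewrite (perm_zsum (perm_map _ WV)) -map_comp; congr zsum; apply: eq_map => v /=.
by rewrite !inertia_formE (perm_det_form _ _ WV) det_form_frame.
Qed.

End InvariantFrame.

Section Isomorphism.
Context {R : realType}.
Local Notation hull := Defs.conv.

Definition frame_mx (p q r : pt) : 'M[int]_3 :=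
  \matrix_(i, j) int_of_Z (coordinate (nth p [:: p; q; r] i) j).

Lemma zrow_frame p q r x : zrow (frame p q r x) = zrow x *m frame_mx p q r.
Proof.
apply/matrixP => i j; rewrite ord1 [RHS]mxE.
rewrite !big_ord_recl big_ord0 !mxE /= addr0 -!rmorphM -!raddfD /=; congr int_of_Z.
rewrite -[RHS]/(_ + (_ + _))%Z -![(_ * coordinate _ _)%R]/(_ * _)%Z.
case: p q r x => [[? ?] ?] [[? ?] ?] [[? ?] ?] [[? ?] ?].
by case: j => [[|[|[|//]]] hj]; rewrite /coordinate /= /bump /=; lia.
Qed.

Lemma embZ_mulmx (m : 'rV[int]_3) (A : 'M[int]_3) :
  embZ (m *m A) = embZ m *m map_mx intr A :> 'rV[R]_3.
Proof. by rewrite /embZ map_mxM. Qed.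

Lemma hull_linear (f : {linear 'rV[R]_3 -> 'rV[R]_3}) (A : set 'rV[R]_3) :
  f @` hull A = hull (f @` A).
Proof.
apply/seteqP; split.
  move=> _ [x hx <-].
  apply: (@hull_sub _ _ A [set x | hull (f @` A) (f x)]) => //.
    move=> y z k /= hy hz k0 k1; rewrite linearD !linearZ.
    exact: hull_closed.
  by move=> y Ay; apply: sub_hull; exists y.
apply: hull_sub.
  move=> _ _ k [y hy <-] [z hz <-] k0 k1.
  exists (k *: y + (1 - k) *: z); first exact: hull_closed.
  by rewrite linearD !linearZ.
by move=> _ [y Ay <-]; exists y => //; exact: sub_hull.
Qed.

Lemma eq_mem_pts V W : V =i W -> pts V = pts W :> set 'rV[R]_3.
Proof.
move=> VW; apply/seteqP; split=> x /ptsP[v vV ->]; apply: pts_vec.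
  by rewrite -VW.
by rewrite VW.
Qed.

(** Right multiplication by the matrix with rows [p], [q], [r] acts as
    [frame p q r], both on the lattice and on real space. *)
Lemma frame_lattice_isomorphic p q r p' q' r' V :
  cancel (frame p q r) (frame p' q' r') ->
  cancel (frame p' q' r') (frame p q r) ->
  lattice_isomorphic (hull (@pts R V)) (hull (pts [seq frame p q r v | v <- V])).
Proof.
move=> K K'; pose A := frame_mx p q r.
exists (mulmxr A), (mulmxr (map_mx intr A)); split.
- exists (mulmxr (frame_mx p' q' r')) => m /=.
    by rewrite -(zptK m) -!zrow_frame K.
  by rewrite -(zptK m) -!zrow_frame K'.
- by move=> m; rewrite /= embZ_mulmx.
- rewrite hull_linear; congr hull; apply/seteqP; split=> x.
    move=> [_ /ptsP[v vV ->] <-]; rewrite /= -embZ_mulmx -zrow_frame.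
    by apply: pts_vec; exact: map_f.
  move=> /ptsP[w wV ->]; move: wV => /mapP[v vV ->].
  by exists (vec v); [exact: pts_vec|rewrite /= -embZ_mulmx -zrow_frame].
Qed.

Lemma isomorphic_pts_lattice V L :
  isomorphic_pts V L ->
  lattice_isomorphic (hull (@pts R V)) (hull (pts L)).
Proof.
move=> [a [b [c [a' [b' [c' [D D' E]]]]]]].
pose F x := frame a' b' c' (coords a b c x).
pose G x := frame a b c (coords a' b' c' x).
have FE x : F x = frame (F e1) (F e2) (F e3) x.
  by rewrite /F coords_as_frame frame_frame.
have GE x : G x = frame (G e1) (G e2) (G e3) x.
  by rewrite /G coords_as_frame frame_frame.
have FG : cancel (frame (F e1) (F e2) (F e3)) (frame (G e1) (G e2) (G e3)).
  by move=> x; rewrite -FE -GE /F /G coords_frame // frame_coords.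
have GF : cancel (frame (G e1) (G e2) (G e3)) (frame (F e1) (F e2) (F e3)).
  by move=> x; rewrite -FE -GE /F /G coords_frame // frame_coords.
have LE : L =i [seq F v | v <- V].
  move=> x; apply/idP/mapP => [xL|[v vV ->]].
    have := map_f (coords a' b' c') xL; rewrite -E => /mapP[v vV vx].
    by exists v; rewrite // /F -vx frame_coords.
  have := map_f (coords a b c) vV; rewrite E => /mapP[w wL vw].
  by rewrite /F vw frame_coords.
by rewrite (eq_mem_pts LE) (eq_map FE); exact: frame_lattice_isomorphic.
Qed.

Definition lattice_points_of (P : set 'rV[R]_3) (V : seq pt) : Prop :=
  forall v, v \in V <-> P (vec v) /\ v <> (0, 0, 0)%Z.

(** A lattice isomorphism acts on lattice points by a matrix of determinant [1]
    or [-1] and maps the nonzero lattice points of [P] onto those of [Q]. *)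
Lemma lattice_isomorphic_invariant P Q V W : uniq V -> uniq W ->
  lattice_points_of P V -> lattice_points_of Q W ->
  lattice_isomorphic P Q -> invariant W = invariant V.
Proof.
move=> uV uW ptV ptW [phi [phiR [[psi phiK psiK] phiE PQ]]].
pose g v := zpt (phi (zrow v)); pose h v := zpt (psi (zrow v)).
have gh v : g (h v) = v by rewrite /g /h zptK psiK zrowK.
have hg v : h (g v) = v by rewrite /g /h zptK phiK zrowK.
have phi_vec v : phiR (vec v) = vec (g v) by rewrite /vec /g phiE zptK.
have phi_comb (x : 'rV[R]_3) : phiR x =
    x 0 0 *: vec (g e1) + x 0 1 *: vec (g e2) + x 0 2%:R *: vec (g e3).
  have xE : x = x 0 0 *: vec e1 + x 0 1 *: vec e2 + x 0 2%:R *: vec e3.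
    apply/matrixP => i j; rewrite ord1 !mxE -!/(realZ _) /=; move: j.
    by apply: ord3P; rewrite /= ?realZ0 ?realZ1; ring.
  by rewrite {1}xE !linearD !linearZ /= !phi_vec.
have gE v : g v = frame (g e1) (g e2) (g e3) v.
  apply: (@vec_inj R); rewrite -phi_vec phi_comb; case: v => [[x y] z].
  by rewrite /frame !vecD !vecZ !vecE.
have D : (det (g e1) (g e2) (g e3) * det (g e1) (g e2) (g e3) = 1)%Z.
  have := det_frame (g e1) (g e2) (g e3) (h e1) (h e2) (h e3).
  by rewrite -!gE !gh => /esym/Z.mul_eq_1; lia.
have phi_inj (x : 'rV[R]_3) : phiR x = 0 -> x = 0.
  rewrite phi_comb => E.
  have E1 := congr1 (pairing ^~ (vec (dual_vec (g e1) (g e2) (g e3)))) E.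
  have E2 := congr1 (pairing ^~ (vec (dual_vec (g e2) (g e3) (g e1)))) E.
  have E3 := congr1 (pairing ^~ (vec (dual_vec (g e3) (g e1) (g e2)))) E.
  have D2 : (det (g e2) (g e3) (g e1) * det (g e2) (g e3) (g e1) = 1)%Z.
    by rewrite (det_cyc (g e1)).
  have D3 : (det (g e3) (g e1) (g e2) * det (g e3) (g e1) (g e2) = 1)%Z.
    by rewrite (det_cyc (g e2)) (det_cyc (g e1)).
  move: E1 E2 E3; rewrite !pairingDl !pairingZl !pairing_vec !pairing0l.
  rewrite !dot_dual_fst !dot_dual_cyc !dot_dual_last D D2 D3 realZ0 realZ1.
  rewrite !mulr0 !mulr1 !addr0 !add0r => E1 E2 E3.
  by apply/matrixP => i j; rewrite ord1 [RHS]mxE; move: j; apply: ord3P.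
have g0 v : g v = (0, 0, 0)%Z -> v = (0, 0, 0)%Z.
  move=> gv; apply: (@vec_inj R); rewrite vec0; apply: phi_inj.
  by rewrite phi_vec gv vec0.
have g00 : g (0, 0, 0)%Z = (0, 0, 0)%Z.
  by apply: (@vec_inj R); rewrite -phi_vec vec0 linear0.
apply: (invariant_frame D); apply: uniq_perm => //.
  rewrite map_inj_uniq // => x y; rewrite -!gE => E.
  by rewrite -(hg x) E hg.
move=> w; apply/idP/mapP => [/ptW[Qw w0]|[v vV ->]].
  exists (h w); last by rewrite -gE gh.
  apply/ptV; split; last by move=> E; apply: w0; rewrite -(gh w) E.
  move: Qw; rewrite -PQ => -[x Px xw].
  suff <- : x = vec (h w) by [].
  apply/eqP; rewrite -subr_eq0; apply/eqP/phi_inj.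
  by rewrite linearB /= xw phi_vec gh subrr.
have [Pv v0] := (ptV v).1 vV; apply/ptW; rewrite -gE; split; last by move/g0.
by rewrite -PQ -phi_vec; exists (vec v).
Qed.

End Isomorphism.

(** * The representatives *)

Lemma size_representatives : size representatives = 100.
Proof. by []. Qed.

Lemma uniq_invariants : uniq [seq invariant L | L <- representatives].
Proof. by lazy. Qed.

Lemma representatives_unimodular :
  all (fun L => [&& unimodular_hullb L, facet_triple L e1 e2 e3 &
                    (0, 0, 0)%Z \notin L]) representatives.
Proof. by lazy. Qed.

Section Representatives.
Context {R : realType}.
Local Notation hull := Defs.conv.
Variables (L : seq pt) (a b c : pt).
Hypotheses (L_unimodular : unimodular_hull L) (abc : facet_triple L a b c).

Lemma hull_lattice_points : (0, 0, 0)%Z \notin L ->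
  lattice_points_of (hull (@pts R L)) L.
Proof.
move=> L0 v; split=> [vL|[hv v0]].
  split; first by apply: sub_hull; exact: pts_vec.
  by move=> E; case/negP: L0; rewrite -E.
have [|/ptsP[w wL /vec_inj ->] //] :=
  hull_lattice L_unimodular abc hv (vec_lattice v).
by rewrite -vec0 => /vec_inj.
Qed.

(** Unimodularity passes to the subset of the vertices: its facet triples are
    facet triples of the whole set. *)
Lemma unimodular_hull_terminal : terminal (hull (@pts R L)).
Proof.
have refl := hull_reflexive (R := R) L_unimodular abc.
have [latP _ _ _] := refl.
have [W [uW hW vW]] := lattice_polytope_vertices latP.
apply: (unimodular_terminal refl hW vW) => x y z xyz.
have [D xW yW zW le] := facet_tripleP _ _ _ _ xyz.
have WL w : w \in W -> w \in L.
  move=> wW; have := pts_vec (R := R) wW.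
  by rewrite -vW => /vertex_hull/mapP[v vL /vec_inj ->].
split; last exact: exists_negative refl hW _ (dual_vec_neq0 D).
suff /facet_det : facet_triple L x y z by apply.
apply/facet_tripleP; split; rewrite ?WL // => v vL.
suff : pairing (vec v) (vec (facet_vec x y z)) <=
    realZ (det x y z * det x y z)%Z :> R.
  by rewrite pairing_vec realZ_le; lia.
apply: (@hull_le_form _ _ (pts W)); last first.
  by rewrite -hW; apply: sub_hull; exact: pts_vec.
by move=> _ /ptsP[w wW ->]; rewrite pairing_vec realZ_le; have := le w wW; lia.
Qed.

End Representatives.

(** * Facets *)

Lemma det_parallelogram v x w a b c :
  let s := [:: v; x; w; add (add v x) (opp w)] in
  a \in s -> b \in s -> c \in s ->
  [\/ det a b c = 0, det a b c = det v x w | det a b c = - det v x w]%Z.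
Proof.
move=> s; rewrite !inE => /or4P[] /eqP -> /or4P[] /eqP -> /or4P[] /eqP -> {s a b c}.
all: first [by constructor 1; move: v x w; ptring
           |by constructor 2; move: v x w; ptring
           |by constructor 3; move: v x w; ptring].
Qed.

Section Facets.
Context {R : realType}.
Local Notation hull := Defs.conv.

Lemma embZE (m : 'rV[int]_3) : embZ m = vec (zpt m) :> 'rV[R]_3.
Proof. by rewrite /vec zptK. Qed.

Lemma zrow_frame_sum a b c x :
  zrow (frame a b c x) =
  \sum_(i < 3) zrow x 0 i *: tnth [tuple zrow a; zrow b; zrow c] i.
Proof.
rewrite zrow_frame; apply/matrixP => i j; rewrite ord1 mxE summxE.
apply: eq_bigr => k _; rewrite !mxE; congr (_ * _).
move: k; apply: ord3P; by rewrite (tnth_nth 0) /= !mxE.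
Qed.

Lemma unimodular_Z_basis a b c : (det a b c * det a b c = 1)%Z ->
  Z_basis [tuple zrow a; zrow b; zrow c].
Proof.
move=> D m; exists (zrow (coords a b c (zpt m))); split.
  by rewrite -zrow_frame_sum frame_coords // zptK.
move=> x; rewrite -[x]zptK -zrow_frame_sum => ->.
by rewrite zrowK coords_frame.
Qed.

Lemma Z_basis_unimodular a b c :
  Z_basis [tuple zrow a; zrow b; zrow c] -> (det a b c * det a b c = 1)%Z.
Proof.
move=> basis.
have comb u : exists x, frame a b c x = u.
  have [x [xE _]] := basis (zrow u); exists (zpt x).
  by apply: (can_inj zrowK); rewrite xE -{2}[x]zptK zrow_frame_sum.
have [x1 E1] := comb e1; have [x2 E2] := comb e2; have [x3 E3] := comb e3.
have := det_frame a b c x1 x2 x3; rewrite E1 E2 E3.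
by move=> /esym/Z.mul_eq_1; lia.
Qed.

(** A convex combination attains the minimum of a form over the generators only
    if all generators with positive weight do. *)
Lemma face_hull (s : seq 'rV[R]_3) (w : 'rV[R]_3) (e : R) x :
  (forall v, v \in s -> e <= pairing v w) ->
  hull [set` s] x -> pairing x w = e ->
  hull [set` [seq v <- s | pairing v w == e]] x.
Proof.
move=> ge hx; pose F := hull [set` [seq v <- s | pairing v w == e]].
suff : [set x | e <= pairing x w /\ (pairing x w = e -> F x)] x by case.
move: x hx; apply: hull_sub => [y z k [hy Fy] [hz Fz] k0 k1|v /= vs]; last first.
  split; first exact: ge.
  by move=> /eqP ve; apply: sub_hull; rewrite /= mem_filter ve.
have [->|kn0] := eqVneq k 0; first by rewrite scale0r add0r subr0 scale1r.
have [->|kn1] := eqVneq k 1; first by rewrite subrr scale0r addr0 scale1r.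
have kp : 0 < k by rewrite lt_neqAle eq_sym kn0.
have k'p : 0 < 1 - k by rewrite subr_gt0 lt_neqAle kn1.
rewrite /= pairingDl !pairingZl; split; first by nra.
by move=> E; apply: hull_closed => //; [apply: Fy|apply: Fz]; nra.
Qed.

(** Every vector has a positive multiple in [P], so the edge vectors of an affine
    basis of [P] span the space. *)
Lemma interior_has_dim (P : set 'rV[R]_3) k :
  interior P 0 -> has_dim P k -> k = 3%nat.
Proof.
move=> int0 [v [/eqP free _ span]].
have full (x : 'rV[R]_3) : (x <= edge_mx v)%MS.
  have [t t0 Pt] := interior_scale x int0.
  have P0 : P 0 by exact: interior_subset int0.
  rewrite -(scale1r x) -(mulVf (x := t)) ?gt_eqF // -scalerA scalemx_sub //.
  have -> : t *: x = (t *: x - v ord0) - (0 - v ord0).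
    by rewrite sub0r opprK subrK.
  by rewrite addmx_sub ?eqmx_opp ?span.
have : row_full (edge_mx v) by rewrite -sub1mx; apply/row_subP => i; exact: full.
by rewrite /row_full free => /eqP.
Qed.

Lemma triple_edge_mulmx a b c (z : 'rV[R]_2) :
  z *m edge_mx (fun i : 'I_3 => nth 0 [:: vec a; vec b; vec c] i) =
  z 0 0 *: (vec b - vec a) + z 0 1 *: (vec c - vec a).
Proof.
apply/matrixP => i j; rewrite ord1 !mxE !big_ord_recl big_ord0 addr0 !mxE.
by congr (_ * _ + _ * _); congr (z _ _); apply: val_inj.
Qed.

Lemma triple_affinely_independent a b c : det a b c <> 0%Z ->
  affinely_independent
    (fun i : 'I_3 => nth 0 [:: vec a; vec b; vec c] i : 'rV[R]_3).
Proof.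
move=> D; pose M : R := realZ (det a b c * det a b c)%Z.
have Mn : M != 0 by rewrite gt_eqF // (realZ_lt 0); nia.
apply/inj_row_free => z; rewrite triple_edge_mulmx => E.
have hb := congr1 (pairing ^~ (vec (dual_vec b c a))) E.
have hc := congr1 (pairing ^~ (vec (dual_vec c a b))) E.
move: hb hc; rewrite !pairingDl !pairingZl !pairingDl !pairingNl !pairing_vec.
rewrite !dot_dual_fst !dot_dual_cyc !dot_dual_last !pairing0l.
rewrite (det_cyc b c a) (det_cyc a b c) -/M realZ0 !subr0 !mulr0 addr0 add0r.
move=> /eqP; rewrite mulf_eq0 (negPf Mn) orbF => /eqP z0.
move=> /eqP; rewrite mulf_eq0 (negPf Mn) orbF => /eqP z1.
apply/matrixP => i j; rewrite ord1 [RHS]mxE.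
case: j => [[|[|//]]] hj; [rewrite -[RHS]z0|rewrite -[RHS]z1]; congr (z _ _);
  exact: val_inj.
Qed.

Section Reflexive.
Variables (P : set 'rV[R]_3) (V : seq pt).
Hypotheses (P_reflexive : reflexive_polytope P) (P_hull : P = hull (pts V))
  (P_vertices : vertices P = pts V).

Definition facet_of a b c : set 'rV[R]_3 := P `&`
  [set x | pairing x (vec (facet_vec a b c)) = realZ (det a b c * det a b c)%Z].

Lemma facet_of_hull a b c : facet_triple V a b c ->
  facet_of a b c = hull (pts
    [seq v <- V | dot v (facet_vec a b c) == (det a b c * det a b c)%Z]).
Proof.
move=> /facet_tripleP[_ _ _ _ le]; apply/seteqP; split=> x.
  move=> [Px /= xE]; rewrite P_hull in Px.
  have := @face_hull _ (- vec (facet_vec a b c))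
    (- realZ (det a b c * det a b c)%Z) x _ Px.
  rewrite pairingNr xE => /(_ _ erefl) h; apply: hull_le (h _).
    move=> y /=; rewrite mem_filter => /andP[/eqP + /mapP[v vV yv]].
    rewrite yv pairingNr pairing_vec => /oppr_inj/realZ_inj vE.
    by apply: sub_hull; apply: pts_vec; rewrite mem_filter vE eqxx.
  move=> _ /mapP[v vV ->]; rewrite pairingNr pairing_vec lerN2 realZ_le.
  by have := le v vV; lia.
move=> hx; split.
  rewrite P_hull; move: x hx; apply: hull_le => _ /ptsP[v + ->].
  by rewrite mem_filter => /andP[_ vV]; apply: sub_hull; exact: pts_vec.
have eqv v : pts [seq v <- V |
      dot v (facet_vec a b c) == (det a b c * det a b c)%Z] v ->
    pairing v (vec (facet_vec a b c)) = realZ (det a b c * det a b c)%Z.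
  move=> /ptsP[u + ->]; rewrite mem_filter pairing_vec => /andP[/eqP ->].
  by [].
apply/eqP; rewrite eq_le; apply/andP; split.
  by apply: hull_le_form hx => v /eqv ->.
by apply: hull_ge hx => v /eqv ->.
Qed.

(** A facet is cut out by the plane of three independent vertices: otherwise its
    vertices, hence all its points, are orthogonal to a vector [d], which is
    independent of the normal [w] of the facet, and two forms that are constant
    on the facet leave it at most one dimension. *)
Lemma is_facet_triple F : is_facet P F ->
  exists a b c, facet_triple V a b c /\ F = facet_of a b c.
Proof.
move=> [[w [e [ge FE]]] [k [dimP dimF]]].
have [_ _ int0 _] := P_reflexive.
have [k2] := interior_has_dim int0 dimP; subst k.
have P0 : P 0 by exact: interior_subset int0.
have e0 : e < 0.
  have := ge _ P0; rewrite pairing0l le_eqVlt => /predU1P[e0|//].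
  have [w0|w0] := eqVneq w 0.
    suff FP : F = P.
      by have := interior_has_dim int0; rewrite -FP => /(_ _ dimF).
    rewrite FE w0 e0; apply/seteqP; split=> x; first by case.
    by move=> Px; split=> //=; rewrite pairing0r.
  have [t t0 /ge] := interior_scale (- w) int0.
  rewrite e0 pairingZl pairingNl pmulr_rge0 // oppr_ge0 leNgt.
  by rewrite pairing_gt0.
pose VF := [seq v <- V | pairing (vec v) w == e].
have F_hull x : F x -> hull (pts VF) x.
  rewrite FE => -[Px xe]; rewrite P_hull in Px.
  have := face_hull _ Px xe => /(_ _) h; apply: hull_le (h _).
    move=> y /=; rewrite mem_filter => /andP[/eqP ve /mapP[v vV vE]].
    rewrite vE; apply: sub_hull; apply: pts_vec; rewrite mem_filter vV -vE ve.
    by rewrite eqxx.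
  by move=> _ /mapP[v vV ->]; apply: ge; exact: (reflexive_pts P_hull).
have [[a [b [c []]]]|[d d0 dVF]] := independent_triple_or_normal VF.
  rewrite !mem_filter => /andP[/eqP aw aV] /andP[/eqP bw bV] /andP[/eqP cw cV] D.
  pose M : R := realZ (det a b c * det a b c)%Z.
  have M0 : 0 < M by rewrite (realZ_lt 0); nia.
  have fE : vec (facet_vec a b c) = (M / e) *: w.
    apply/eqP; rewrite -subr_eq0; apply/eqP.
    apply: (orthogonal_eq0 D); rewrite pairingDl pairingNl pairingZl (pairingC w)
      (pairingC (vec (facet_vec a b c))).
    - by rewrite pairing_vec dot_facet_fst aw divfK ?subrr // lt_eqF.
    - by rewrite pairing_vec dot_facet_snd bw divfK ?subrr // lt_eqF.
    - by rewrite pairing_vec dot_facet_trd cw divfK ?subrr // lt_eqF.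
  exists a, b, c; split.
    apply/facet_tripleP; split=> // v vV.
    have := ge _ (reflexive_pts P_hull vV) => h.
    suff : pairing (vec v) (vec (facet_vec a b c)) <= M.
      by rewrite pairing_vec realZ_le; lia.
    rewrite fE pairingZr -mulrA ler_piMr ?(ltW M0) //.
    by rewrite mulrC ler_ndivrMr // mul1r.
  rewrite FE /facet_of fE -/M; apply/seteqP; split=> x [Px /= xE]; split=> //=.
    by rewrite pairingZr xE divfK // lt_eqF.
  move: xE; rewrite pairingZr => /(canRL (mulKf _)) ->; last first.
    by apply: mulf_neq0; [rewrite gt_eqF|rewrite invr_eq0 lt_eqF].
  by rewrite invfM invrK mulrAC mulVf ?mul1r // gt_eqF.
have [v [/eqP free Fv _]] := dimF; exfalso.
have orth x : F x -> pairing x (vec d) = 0.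
  move=> /F_hull hx; have eqv u : pts VF u -> pairing u (vec d) = 0.
    by move=> /ptsP[y yVF ->]; rewrite pairing_vec dVF.
  apply/eqP; rewrite eq_le; apply/andP; split.
    by apply: hull_le_form hx => u /eqv ->.
  by apply: hull_ge hx => u /eqv ->.
have onF x : F x -> pairing x w = e by rewrite FE => -[].
pose B := col_mx (vec d) w : 'M[R]_(1 + 1, 3).
have Bfree : row_free B.
  apply/inj_row_free => z; rewrite -[z]hsubmxK mul_row_col => E.
  have zE (y : 'M[R]_1) : y = (y 0 0)%:M by exact: mx11_scalar.
  rewrite (zE (lsubmx z)) (zE (rsubmx z)) !mul_scalar_mx in E *.
  have := congr1 (pairing (v ord0)) E.
  rewrite pairingDr !pairingZr orth // onF // mulr0 add0r pairing0r.
  move/eqP; rewrite mulf_eq0 (lt_eqF e0) orbF => /eqP z2.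
  move: E; rewrite z2 scale0r addr0 => /eqP; rewrite scaler_eq0 => /orP[/eqP z1|].
    by rewrite z1 !raddf0 row_mx0.
  by rewrite -vec0 => /eqP/vec_inj.
have E0 : edge_mx v *m B^T = 0.
  apply/matrixP => i j; rewrite [RHS]mxE.
  have -> : (edge_mx v *m B^T) i j = pairing (v (lift ord0 i) - v ord0) (row j B).
    by rewrite mxE; apply: eq_bigr => l _; rewrite !mxE.
  rewrite pairingDl pairingNl; case: (split_ordP j) => m ->.
    by rewrite rowKu row_id !orth // subrr.
  by rewrite rowKd row_id !onF // subrr.
have := mulmx0_rank_max E0.
by rewrite free mxrank_tr (eqP Bfree).
Qed.

Lemma triple_is_facet a b c : facet_triple V a b c -> is_facet P (facet_of a b c).
Proof.
move=> /facet_tripleP[D aV bV cV le].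
pose M : R := realZ (det a b c * det a b c)%Z.
have M0 : 0 < M by rewrite (realZ_lt 0); nia.
have Mn : M != 0 by rewrite gt_eqF.
have [_ dim3 _ _] := P_reflexive.
split.
  exists (- vec (facet_vec a b c)), (- M); split.
    move=> x; rewrite P_hull pairingNr lerN2; apply: hull_le_form.
    move=> _ /ptsP[v vV ->]; rewrite pairing_vec realZ_le.
    by have := le v vV; lia.
  rewrite /facet_of; congr (_ `&` _); apply/seteqP; split=> x /=.
    by rewrite pairingNr => ->.
  by rewrite pairingNr => /oppr_inj.
exists 2; split=> //.
pose v (i : 'I_3) : 'rV[R]_3 := nth 0 [:: vec a; vec b; vec c] i.
exists v; split; first exact: triple_affinely_independent.
- case=> [[|[|[|//]]]] hi; rewrite /v /=; split=> /=;
    rewrite ?pairing_vec ?dot_facet_fst ?dot_facet_snd ?dot_facet_trd //;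
    exact: (reflexive_pts P_hull).
move=> x [_ /= xE]; apply/submxP.
exists (\row_(j < 2) (M^-1 * pairing x (vec (if j == 0 then dual_vec b c a
                                          else dual_vec c a b)))).
rewrite triple_edge_mulmx !mxE /=; apply: (scalerI Mn).
move: xE; rewrite pairing_facet_vec -/M => sum.
have := frame_coords_real a b c x; rewrite -/M => fx.
rewrite scalerBr {}fx scalerDr !scalerA !mulVKf // /v /= -sum.
move: (vec a) (vec b) (vec c) => u1 u2 u3; apply/matrixP => i j.
by rewrite !mxE; ring.
Qed.

Lemma facet_vertex F v : F `<=` P -> F (vec v) -> v \in V -> vertices F (vec v).
Proof.
move=> FP Fv vV; apply: face_trans FP Fv.
have : vertices P (vec v) by rewrite P_vertices; exact: pts_vec.
by [].
Qed.

Lemma hull3_range a b c :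
  hull (range (fun i : 'I_3 => nth 0 [:: vec a; vec b; vec c] i)) =
  hull (@pts R [:: a; b; c]).
Proof.
congr hull; apply/seteqP; split=> x.
  by move=> [[[|[|[|//]]] hi] _ <-]; apply: pts_vec; rewrite !inE eqxx ?orbT.
move=> /ptsP[v + ->]; rewrite !inE => /or3P[] /eqP ->.
- by exists 0.
- by exists 1.
- by exists 2%:R.
Qed.

Lemma triangle_unimodular_simplex a b c :
  unimodular_hull V -> triangle V a b c -> unimodular_simplex (facet_of a b c).
Proof.
move=> uV [abc on]; have D := facet_det uV abc.
have FE := facet_of_hull abc; rewrite D in FE.
have [_ aV bV cV _] := facet_tripleP _ _ _ _ abc.
have s3 v : v \in [:: a; b; c] -> v \in V /\ dot v (facet_vec a b c) = 1%Z.
  rewrite !inE => /or3P[] /eqP ->; split=> //.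
  - by rewrite dot_facet_fst.
  - by rewrite dot_facet_snd.
  - by rewrite dot_facet_trd.
have F3 : facet_of a b c = hull (pts [:: a; b; c]).
  rewrite FE; congr hull; apply: eq_mem_pts => v; rewrite mem_filter.
  by apply/andP/idP => [[/eqP h vV]|/s3[vV ->]]; [exact: on|rewrite eqxx].
split.
  exists 2, (fun i : 'I_3 => nth 0 [:: vec a; vec b; vec c] i).
  rewrite hull3_range; split=> //.
  have [? _ _ _ _] := facet_tripleP _ _ _ _ abc.
  exact: triple_affinely_independent.
exists [tuple zrow a; zrow b; zrow c]; split; first exact: unimodular_Z_basis.
apply/seteqP; split=> x.
  rewrite F3 => /vertex_hull/mapP[w + ->]; rewrite !inE => /or3P[] /eqP ->.
  - by exists (zrow a); rewrite //= !inE eqxx.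
  - by exists (zrow b); rewrite //= !inE eqxx ?orbT.
  - by exists (zrow c); rewrite //= !inE eqxx ?orbT.
move=> [m /=]; rewrite !inE => h <-.
have {h} : m \in [seq zrow w | w <- [:: a; b; c]] by rewrite !inE.
move=> /mapP[w ws ->]; rewrite -/(vec w).
have [wV _] := s3 w ws; apply: facet_vertex wV; first by move=> ? [].
by rewrite F3; apply: sub_hull; exact: pts_vec.
Qed.

Lemma parallelogram_unimodular a b c :
  unimodular_hull V -> parallelogram V a b c ->
  unimodular_parallelogram (facet_of a b c).
Proof.
move=> uV [abc dV on]; have D := facet_det uV abc.
have FE := facet_of_hull abc; rewrite D in FE.
have [_ aV bV cV _] := facet_tripleP _ _ _ _ abc.
have s4 v : v \in [:: a; b; c; add (add a b) (opp c)] ->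
    v \in V /\ dot v (facet_vec a b c) = 1%Z.
  have da : dot a (facet_vec a b c) = 1%Z by rewrite dot_facet_fst.
  have db : dot b (facet_vec a b c) = 1%Z by rewrite dot_facet_snd.
  have dc : dot c (facet_vec a b c) = 1%Z by rewrite dot_facet_trd.
  rewrite !inE => /or4P[] /eqP ->; split=> //.
  by rewrite !dot_addl /opp dot_scalel da db dc.
exists (zrow a), (zrow c), (zrow b), (zrow (add (add a b) (opp c))); split.
- rewrite FE; congr hull; apply/seteqP; split=> x.
    move=> /ptsP[v + ->]; rewrite mem_filter => /andP[/eqP h vV].
    exists (zrow v) => //=.
    have : zrow v \in [seq zrow w | w <- [:: a; b; c; add (add a b) (opp c)]].
      by apply: map_f; exact: on.
    by rewrite !inE => /or4P[] ->; rewrite ?orbT.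
  move=> [m /= h <-].
  have {h} : m \in [seq zrow w | w <- [:: a; b; c; add (add a b) (opp c)]].
    by move: h; rewrite !inE => /or4P[] ->; rewrite ?orbT.
  move=> /mapP[w /s4[wV we] ->]; rewrite -/(vec w); apply: pts_vec.
  by rewrite mem_filter we eqxx.
- exact: unimodular_Z_basis.
- apply: (can_inj zptK); apply: (@vec_inj R).
  rewrite /vec !zptK /embZ !map_mxD -!/(embZ _) -!/(vec _) !vecD vecN.
  by rewrite [RHS]addrC subrK.
Qed.

Lemma unimodular_facets : unimodular_hull V ->
  forall F, is_facet P F -> unimodular_simplex F \/ unimodular_parallelogram F.
Proof.
move=> uV F /is_facet_triple[a [b [c [abc ->]]]].
have cyc x y z : facet_of y z x = facet_of x y z.
  by rewrite /facet_of facet_vec_cyc (det_cyc x).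
have [tri|par|par|par] := facet_shape uV abc.
- by left; exact: triangle_unimodular_simplex.
- by right; exact: parallelogram_unimodular.
- by right; rewrite -cyc; exact: parallelogram_unimodular.
- by right; rewrite -cyc -cyc; exact: parallelogram_unimodular.
Qed.

(** The vertices of a facet triple are vertices of its facet, hence belong to a
    basis of the lattice or to a parallelogram spanned by one; any three
    independent ones among these have determinant [1] or [-1]. *)
Lemma facets_unimodular :
  (forall F, is_facet P F -> unimodular_simplex F \/ unimodular_parallelogram F) ->
  unimodular_hull V.
Proof.
move=> unim a b c abc; have [D aV bV cV _] := facet_tripleP _ _ _ _ abc.
split; last exact: exists_negative P_reflexive P_hull _ (dual_vec_neq0 D).
have vert v : v \in [:: a; b; c] -> vertices (facet_of a b c) (vec v).
  rewrite !inE => /or3P[] /eqP ->; apply: facet_vertex => //; try by move=> ? [].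
  - by split; [exact: (reflexive_pts P_hull)|rewrite /= pairing_vec dot_facet_fst].
  - by split; [exact: (reflexive_pts P_hull)|rewrite /= pairing_vec dot_facet_snd].
  - by split; [exact: (reflexive_pts P_hull)|rewrite /= pairing_vec dot_facet_trd].
suff [x [y [z [basis sub]]]] : exists x y z,
    Z_basis [tuple zrow x; zrow y; zrow z] /\
    forall v, v \in [:: a; b; c] -> v \in [:: x; y; z; add (add x y) (opp z)].
  have U := Z_basis_unimodular basis.
  have sa : a \in [:: a; b; c] by rewrite mem_head.
  have sb : b \in [:: a; b; c] by rewrite !inE eqxx orbT.
  have sc : c \in [:: a; b; c] by rewrite !inE eqxx !orbT.
  by have [|->|->] := det_parallelogram (sub _ sa) (sub _ sb) (sub _ sc); lia.
have [[_ [t [basis vE]]]|[v [w [x [y [FE basis vxwy]]]]]] :=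
    unim _ (triple_is_facet abc).
  exists (zpt (tnth t 0)), (zpt (tnth t 1)), (zpt (tnth t 2%:R)); rewrite !zptK.
  have tE : t = [tuple tnth t 0; tnth t 1; tnth t 2%:R].
    by apply: eq_from_tnth; apply: ord3P; rewrite [RHS](tnth_nth 0).
  split=> [|u us]; first by rewrite -tE.
  have := vert u us; rewrite vE => -[m /= mt mE].
  have -> : u = zpt m by apply: (@vec_inj R); rewrite -mE embZE.
  move: mt; rewrite tE !inE => /or3P[] /eqP ->; rewrite !(tnth_nth 0) /=;
    by rewrite ?eqxx ?orbT.
exists (zpt v), (zpt x), (zpt w); rewrite !zptK; split=> // u us.
have yE : zpt y = add (add (zpt v) (zpt x)) (opp (zpt w)).
  apply: (@vec_inj R); rewrite !vecD vecN -!embZE.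
  have -> : embZ v + embZ x = embZ w + embZ y :> 'rV[R]_3.
    by rewrite /embZ -!map_mxD vxwy.
  by rewrite addrC addKr.
have := vert u us; rewrite FE.
have -> : embZ @` [set` [:: v; w; x; y]] =
    pts [:: zpt v; zpt w; zpt x; zpt y] :> set 'rV[R]_3.
  apply/seteqP; split=> r.
    move=> [m /= ms <-]; rewrite embZE; apply: pts_vec.
    by move: ms; rewrite !inE => /or4P[] /eqP ->; rewrite eqxx ?orbT.
  move=> /ptsP[m + ->]; rewrite !inE => /or4P[] /eqP ->;
    rewrite -embZE; [exists v|exists w|exists x|exists y] => //=;
    by rewrite !inE eqxx ?orbT.
move=> /vertex_hull/mapP[m + /vec_inj ->]; rewrite -yE !inE.
by move=> /or4P[] /eqP ->; rewrite eqxx ?orbT.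
Qed.

End Reflexive.
End Facets.

Theorem theorem4p2 (R : realType) :
  (exists f : 'I_100 -> set 'rV[R]_3,
     [/\ forall i, reflexive_polytope (f i) /\ terminal (f i),
         forall i j, lattice_isomorphic (f i) (f j) -> i = j &
         forall P : set 'rV[R]_3, reflexive_polytope P -> terminal P ->
           exists i, lattice_isomorphic P (f i)]) /\
  (forall P : set 'rV[R]_3, reflexive_polytope P ->
     (terminal P <->
      forall F : set 'rV[R]_3, is_facet P F ->
        unimodular_simplex F \/ unimodular_parallelogram F)).
Proof.
split; last first.
  move=> P refl; have [latP _ _ _] := refl.
  have [V [_ hV vV]] := lattice_polytope_vertices latP; split.
    move=> term; apply: (unimodular_facets refl hV vV).
    exact: terminal_unimodular refl hV vV term.
  by move/(facets_unimodular refl hV vV); exact: unimodular_terminal.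
pose L (i : 'I_100) := nth [::] representatives i.
have LR i : L i \in representatives by rewrite mem_nth // size_representatives.
have good i : [/\ unimodular_hull (L i), facet_triple (L i) e1 e2 e3 &
    (0, 0, 0)%Z \notin L i].
  have /and3P[/unimodular_hullP] := allP representatives_unimodular _ (LR i).
  by [].
exists (fun i => Defs.conv (pts (L i))); split.
- move=> i; have [uL abc L0] := good i.
  by split; [exact: hull_reflexive uL abc|exact: unimodular_hull_terminal uL abc].
- move=> i j iso; have [uLi abci L0i] := good i; have [uLj abcj L0j] := good j.
  have uniqL k := allP uniq_representatives _ (LR k).
  have := lattice_isomorphic_invariant (uniqL i) (uniqL j)
    (hull_lattice_points uLi abci L0i) (hull_lattice_points uLj abcj L0j) iso.
  rewrite -!(nth_map [::] (0, 0)%Z invariant) ?size_representatives // => /eqP.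
  rewrite nth_uniq ?uniq_invariants ?size_map ?size_representatives //.
  by move=> /eqP/ord_inj.
- move=> P refl term; have [latP _ _ _] := refl.
  have [V [uV hV vV]] := lattice_polytope_vertices latP.
  have uniV := terminal_unimodular refl hV vV term.
  have [a [b [c abc]]] := exists_facet_triple refl hV.
  have parV := terminal_parity_free refl hV vV term.
  have [K KR iso] := unimodular_hull_classification uV uniV parV abc.
  have := KR; rewrite -index_mem size_representatives => iK.
  exists (Ordinal iK); rewrite hV /L /= nth_index //.
  exact: isomorphic_pts_lattice.
Qed.
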